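(* Let $d\ge1$, $Q=2d+2$, and let $X_1,\dots,X_{2d}$ be the Heisenberg vector fields on $\mathbb{R}^{2d+1}$. Let $0<\lambda\le\Lambda$, $A$ an index set, $b^\alpha:\mathbb{R}^{2d+1}\to\mathbb{R}^{2d}$, $c^\alpha:\mathbb{R}^{2d+1}\to\mathbb{R}$ with $H_i(x,r,p)=\inf_\alpha\{c^\alpha(x)r-b^\alpha(x)\cdot p\}$ and $H_s(x,r,p)=\sup_\alpha\{c^\alpha(x)r-b^\alpha(x)\cdot p\}$ finite, $b^\alpha$ locally Lipschitz uniformly in $\alpha$ (for every $R>0$ there is $K_R$ with $\sup_{|x|,|y|\le R,\alpha}|b^\alpha(x)-b^\alpha(y)|\le K_R|x-y|$), and $c^\alpha\ge0$ continuous on each ball $\{|x|\le R\}$ uniformly in $\alpha$. Assume $$\sup_{\alpha\in A}\Big\{b^\alpha(x)\cdot\frac{\eta}{|x_H|^2}-c^\alpha(x)\frac{\rho^4}{|x_H|^2}\log\rho\Big\}\le\lambda-\Lambda(Q-1)$$ for all $x$ with $\rho(x)$ sufficiently large and $|x_H|\ne0$. (A) Let $u\in\mathrm{USC}(\mathbb{R}^{2d+1})$ be a viscosity subsolution of $\mathcal{M}^-_{\lambda,\Lambda}((D^2_{\mathbb{H}^d}u)^* )+H_i(x,u,D_{\mathbb{H}^d}u)=0$ in $\mathbb{R}^{2d+1}$ with $\limsup_{|x|\to\infty}\frac{u(x)}{\log\rho(x)}\le0$. If either $c^\alpha\equiv0$ or $u\ge0$, then $u$ is constant. (B) Let $v\in\mathrm{LSC}(\mathbb{R}^{2d+1})$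 be a viscosity supersolution of $\mathcal{M}^+_{\lambda,\Lambda}((D^2_{\mathbb{H}^d}v)^* )+H_s(x,v,D_{\mathbb{H}^d}v)=0$ in $\mathbb{R}^{2d+1}$ with $\liminf_{|x|\to\infty}\frac{v(x)}{\log\rho(x)}\ge0$. If either $c^\alpha\equiv0$ or $v\le0$, then $v$ is constant.
   Context: Heisenberg vector fields on $\mathbb{R}^{2d+1}$: $X_i=\partial_i+2x_{i+d}\partial_{2d+1}$, $X_{i+d}=\partial_{i+d}-2x_i\partial_{2d+1}$, $i=1,\dots,d$. $x_H=(x_1,\dots,x_{2d})$; $\rho(x)=(|x_H|^4+x_{2d+1}^2)^{1/4}$; $\eta\in\mathbb{R}^{2d}$ with $\eta_i=x_i|x_H|^2+x_{i+d}x_{2d+1}$, $\eta_{i+d}=x_{i+d}|x_H|^2-x_ix_{2d+1}$ for $i=1,\dots,d$. $D_{\mathbb{H}^d}u=(X_1u,\dots,X_{2d}u)$, $(D^2_{\mathbb{H}^d}u)_{ij}=X_i(X_ju)$, and $Y^*$ is the symmetrized matrix of $Y$; equations are understood in the viscosity sense after rewriting in Euclidean variables. Pucci operators on symmetric $2d\times2d$ matrices: $\mathcal{M}^+_{\lambda,\Lambda}(M)=\sup\mathrm{Tr}(-AM)$, $\mathcal{M}^-_{\lambda,\Lambda}(M)=\inf\mathrm{Tr}(-AM)$, over symmetric $A$ with $\lambda|\xi|^2\le A\xi\cdot\xi\le\Lambda|\xi|^2$. *)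

(* Defs.v *)
(* Points of R^(2d+1) are row vectors 'rV[R]_((2*d).+1);
   coordinate x_{j+1} of the paper is  x 0 j  (j : 'I_((2*d).+1)), the last
   coordinate x_{2d+1} is  x 0 ord_max. *)
From HB Require Import structures.
From mathcomp Require Import all_boot all_order all_algebra.
From mathcomp Require Import all_classical all_reals all_analysis.
Set Implicit Arguments.
Unset Strict Implicit.
Unset Printing Implicit Defensive.
Import Order.TTheory GRing.Theory Num.Theory.
Import numFieldNormedType.Exports.
Local Open Scope classical_set_scope.
Local Open Scope ring_scope.

Section Heis.
Variables (R : realType) (d : nat).
Notation N := (2 * d).+1.
Notation pt := 'rV[R]_N.

Definition enorm (n : nat) (v : 'rV[R]_n) : R := Num.sqrt (\sum_(i < n) v 0 i ^+ 2).
Definition dotv (n : nat) (v w : 'rV[R]_n) : R := \sum_(i < n) v 0 i * w 0 i.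

Definition evec (j : 'I_N) : pt := delta_mx 0 j.

Definition hidx (k : 'I_(2 * d)) : 'I_N := inord k.
Definition partner (k : 'I_(2 * d)) : 'I_N :=
  inord (if (k < d)%N then (k + d)%N else (k - d)%N).
Definition hsign (k : 'I_(2 * d)) : R := if (k < d)%N then 1 else -1.

(* X_k = d_k + 2 x_{k+d} d_{2d+1}   (k < d)
   X_k = d_k - 2 x_{k-d} d_{2d+1}   (k >= d) *)
Definition Xop (k : 'I_(2 * d)) (f : pt -> R) : pt -> R :=
  fun x => 'D_(evec (hidx k)) f x
           + hsign k * 2 * x 0 (partner k) * 'D_(evec ord_max) f x.

Definition DH (f : pt -> R) (x : pt) : 'rV[R]_(2 * d) := \row_k Xop k f x.
Definition D2H (f : pt -> R) (x : pt) : 'M[R]_(2 * d) :=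
  \matrix_(i, j) Xop i (Xop j f) x.
Definition symmat (n : nat) (Y : 'M[R]_n) : 'M[R]_n := 2^-1 *: (Y + Y^T).

Definition xHnorm2 (x : pt) : R := \sum_(k < 2 * d) x 0 (hidx k) ^+ 2.
Definition rho (x : pt) : R :=
  Num.sqrt (Num.sqrt (xHnorm2 x ^+ 2 + x 0 ord_max ^+ 2)).
(* eta_i = x_i |x_H|^2 + x_{i+d} t,  eta_{i+d} = x_{i+d} |x_H|^2 - x_i t *)
Definition heta (x : pt) : 'rV[R]_(2 * d) :=
  \row_k (x 0 (hidx k) * xHnorm2 x + hsign k * x 0 (partner k) * x 0 ord_max).

Definition pucci_adm (n : nat) (lam Lam : R) (Am : 'M[R]_n) : Prop :=
  Am^T = Am /\ forall xi : 'rV[R]_n,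
    lam * dotv xi xi <= dotv (xi *m Am) xi <= Lam * dotv xi xi.
Definition pucci_plus (n : nat) (lam Lam : R) (M : 'M[R]_n) : R :=
  sup [set \tr (- (Am *m M)) | Am in pucci_adm lam Lam].
Definition pucci_minus (n : nat) (lam Lam : R) (M : 'M[R]_n) : R :=
  inf [set \tr (- (Am *m M)) | Am in pucci_adm lam Lam].

Definition Hinf (A : Type) (b : A -> pt -> 'rV[R]_(2 * d)) (c : A -> pt -> R)
  (x : pt) (r : R) (p : 'rV[R]_(2 * d)) : R :=
  inf [set c a x * r - dotv (b a x) p | a in [set: A]].
Definition Hsup (A : Type) (b : A -> pt -> 'rV[R]_(2 * d)) (c : A -> pt -> R)
  (x : pt) (r : R) (p : 'rV[R]_(2 * d)) : R :=
  sup [set c a x * r - dotv (b a x) p | a in [set: A]].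

Definition C2 (f : pt -> R) : Prop :=
  continuous f /\
  (forall i : 'I_N, (forall x, derivable f x (evec i)) /\ continuous ('D_(evec i) f)) /\
  (forall i j : 'I_N, (forall x, derivable ('D_(evec j) f) x (evec i)) /\
                      continuous ('D_(evec i) ('D_(evec j) f))).

Definition usc (u : pt -> R) : Prop :=
  forall x (e : R), 0 < e -> \forall y \near x, u y < u x + e.
Definition lsc (u : pt -> R) : Prop :=
  forall x (e : R), 0 < e -> \forall y \near x, u x - e < u y.

Definition visc_sub (F : pt -> R -> 'rV[R]_(2 * d) -> 'M[R]_(2 * d) -> R)
  (u : pt -> R) : Prop :=
  forall (phi : pt -> R) (x0 : pt), C2 phi ->
    (\forall y \near x0, u y - phi y <= u x0 - phi x0) ->
    F x0 (u x0) (DH phi x0) (symmat (D2H phi x0)) <= 0.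
Definition visc_super (F : pt -> R -> 'rV[R]_(2 * d) -> 'M[R]_(2 * d) -> R)
  (v : pt -> R) : Prop :=
  forall (phi : pt -> R) (x0 : pt), C2 phi ->
    (\forall y \near x0, v x0 - phi x0 <= v y - phi y) ->
    0 <= F x0 (v x0) (DH phi x0) (symmat (D2H phi x0)).

End Heis.

(* Main.v *)
(* Idea. [log rho] is a supersolution outside a ball: the positive eigenvalues of its horizontal
   Hessian sum to [(Q - 1) |x_H|^2 / rho^4] and the negative one is [- |x_H|^2 / rho^4], so the
   growth condition is exactly what is needed. Hence [u - eps log rho] is a subsolution there
   and cannot have an interior maximum; letting eps tend to 0, u attains its maximum M on a ball.
   By a Hopf-type lemma the horizontal fields are tangent to the closed set [{u = M}] in the
   sense of proximal normals, so this set is invariant under their flows (Bony), and the flows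
   of the X_k connect any two points. All test functions are polynomials. *)
Require Import Defs.
From HB Require Import structures.
From mathcomp Require Import all_boot all_order all_algebra.
From mathcomp Require Import all_classical all_reals all_analysis.
From mathcomp Require Import ring lra zify.
Import Order.TTheory GRing.Theory Num.Theory.
Import numFieldNormedType.Exports.
Local Open Scope classical_set_scope.
Local Open Scope ring_scope.
Set Implicit Arguments.
Unset Strict Implicit.
Unset Printing Implicit Defensive.

(** The growth condition is not strict, so [u - eps log rho] is a subsolution but not a strict one,
    and an interior maximum over an annulus is no contradiction by itself. The Hopf lemma excludes
    it, applied at a maximum point extremal in one horizontal coordinate, whose horizontal gradient
    never vanishes. Applied at a nearest point of the maximum set, the same lemma yields the
    tangency used for propagation. Test functions must be [C2] on the whole space, whereas [log rho]
    is singular at the origin. Only the 2-jet at the contact point enters the equation, so [log rho]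
    may be replaced by a polynomial lying above it with the same 2-jet there, and the exponential of
    the classical Hopf barrier by a quadratic profile. The zeroth order term can be discarded only
    where it has a sign; this is why the comparison is restricted to points where [u - eps log rho]
    exceeds the maximum of u on the ball. *)

Section quadratic_forms.
Context {R : realType} {n : nat}.
Implicit Types (A B : 'M[R]_n) (v w : 'rV[R]_n) (lam Lam : R).

(** * Quadratic forms and admissible Pucci matrices *)

Lemma dotvC v w : dotv v w = dotv w v.
Proof. by apply: eq_bigr => i _; rewrite mulrC. Qed.

Lemma dotvDl u v w : dotv (u + v) w = dotv u w + dotv v w.
Proof. by rewrite -big_split; apply: eq_bigr => i _; rewrite mxE mulrDl. Qed.

Lemma dotvZl (a : R) v w : dotv (a *: v) w = a * dotv v w.
Proof. by rewrite /dotv mulr_sumr; apply: eq_bigr => i _; rewrite mxE mulrA. Qed.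

Lemma dotvDr u v w : dotv u (v + w) = dotv u v + dotv u w.
Proof. by rewrite dotvC dotvDl !(dotvC u). Qed.

Lemma dotvZr (a : R) v w : dotv v (a *: w) = a * dotv v w.
Proof. by rewrite dotvC dotvZl dotvC. Qed.

Lemma dotv_ge0 v : 0 <= dotv v v.
Proof. by apply: sumr_ge0 => i _; rewrite -expr2 sqr_ge0. Qed.

Lemma dotv_eq0 v : (dotv v v == 0) = (v == 0).
Proof.
apply/eqP/eqP => [v0|->]; last by rewrite /dotv big1 // => i _; rewrite mxE mul0r.
apply/rowP => i; rewrite mxE; apply/eqP; rewrite -sqrf_eq0 expr2.
by rewrite (psumr_eq0P _ v0) // => j _; rewrite -expr2 sqr_ge0.
Qed.

Lemma mxtrace_mul_outer A v : \tr (A *m (v^T *m v)) = dotv (v *m A) v.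
Proof.
rewrite mulmxA mxtrace_mulC mulmxA /mxtrace big_ord1 mxE.
by apply: eq_bigr => i _; rewrite [v^T _ _]mxE.
Qed.

Lemma quad_delta A i : dotv (delta_mx 0 i *m A) (delta_mx 0 i) = A i i.
Proof.
rewrite -rowE /dotv (bigD1 i) //= big1 => [|j ji].
  by rewrite !mxE !eqxx mulr1 addr0.
by rewrite !mxE (negbTE ji) andbF mulr0.
Qed.

Lemma dotv_delta i : dotv (delta_mx 0 i : 'rV[R]_n) (delta_mx 0 i) = 1.
Proof. by rewrite -[X in dotv X _]mulmx1 quad_delta mxE eqxx. Qed.

Lemma trace_pucci_adm_le lam Lam A :
  pucci_adm lam Lam A -> \tr A <= Lam * n%:R.
Proof.
move=> [_ hA]; rewrite mulr_natr -[n in leRHS]card_ord -sumr_const.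
apply: ler_sum => i _; rewrite -quad_delta.
by have /andP[_] := hA (delta_mx 0 i); rewrite dotv_delta mulr1.
Qed.

Lemma pucci_adm_scalar lam Lam : lam <= Lam -> pucci_adm lam Lam (lam%:M : 'M[R]_n).
Proof.
move=> lL; split=> [|v]; first by rewrite tr_scalar_mx.
by rewrite mul_mx_scalar dotvZl lexx ler_wpM2r // dotv_ge0.
Qed.

(* [P := m - v^T v - w^T w] is [m] times an orthogonal projection, so
   [m \tr (B P) = \tr (P B P^T)]. *)
Lemma psd_orthogonal_pair_le_trace B v w (m : R) : 0 < m ->
  (forall x, 0 <= dotv (x *m B) x) -> dotv v v = m -> dotv w w = m ->
  dotv v w = 0 -> dotv (v *m B) v + dotv (w *m B) w <= m * \tr B.
Proof.
move=> m0 B0 vv ww vw.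
have dot11 (x y : 'rV[R]_n) : x *m y^T = (dotv x y)%:M.
  apply/matrixP => i j; rewrite !ord1 !mxE eqxx mulr1n.
  by apply: eq_bigr => k _; rewrite mxE.
pose P : 'M[R]_n := m%:M - v^T *m v - w^T *m w.
have PT : P^T = P by rewrite /P !linearB /= tr_scalar_mx !trmx_mul !trmxK.
have vP : v *m P = 0.
  rewrite /P !mulmxBr mul_mx_scalar !mulmxA !dot11 vv vw !mul_scalar_mx subrr.
  by rewrite scale0r subr0.
have wP : w *m P = 0.
  rewrite /P !mulmxBr mul_mx_scalar !mulmxA !dot11 ww dotvC vw !mul_scalar_mx.
  by rewrite scale0r subr0 subrr.
have PP : P *m P = m *: P.
  by rewrite {1}/P !mulmxBl mul_scalar_mx -!mulmxA vP wP !mulmx0 !subr0.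
have : 0 <= \tr (P *m B *m P^T).
  apply: sumr_ge0 => i _; have := B0 (row i P).
  by rewrite -row_mul; congr (_ <= _); rewrite !mxE; apply: eq_bigr => k _; rewrite !mxE.
rewrite mxtrace_mulC PT mulmxA PP -scalemxAl mxtraceZ pmulr_rge0 // mxtrace_mulC.
rewrite /P !mulmxBr mul_mx_scalar !linearB /= linearZ /= !mxtrace_mul_outer.
by rewrite -addrA -opprD subr_ge0.
Qed.

End quadratic_forms.

(** * Explicit 2-jets of test functions *)

Lemma is_derive_val {R : numFieldType} {V W : normedModType R} (f : V -> W) x v df :
  is_derive x v f df -> 'D_v f x = df.
Proof. by case. Qed.

Section jets.
Context {R : realType} {n : nat}.
Implicit Types (f : 'rV[R]_n -> R) (g : 'I_n -> 'rV[R]_n -> R)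
  (H : 'I_n -> 'I_n -> 'rV[R]_n -> R).

(** Gradient and Hessian are carried as explicit functions, so that differentiating a test function
    reduces to ring identities. Symmetry of the Hessian is a field, preserved by every construction,
    in place of Schwarz's theorem. *)
Record jet f g H : Prop := Jet {
  jet_continuous : continuous f;
  jet_continuous1 : forall i, continuous (g i);
  jet_continuous2 : forall i j, continuous (H i j);
  jet_derive1 : forall i x, is_derive x (delta_mx 0 i) f (g i x);
  jet_derive2 : forall i j x, is_derive x (delta_mx 0 i) (g j) (H i j x);
  jet_sym : forall i j x, H i j x = H j i x }.

Lemma jet_ext f f' g g' H H' : jet f g H -> f =1 f' ->
  (forall i, g i =1 g' i) -> (forall i j, H i j =1 H' i j) -> jet f' g' H'.
Proof.
move=> J /funext <- gg HH.
have <- : g = g' by apply/funext => i; apply/funext.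
suff <- : H = H' by [].
by apply/funext => i; apply/funext => j; apply/funext.
Qed.

Lemma jet_cst (a : R) : jet (fun=> a) (fun _ _ => 0) (fun _ _ _ => 0).
Proof.
split=> //; try by move=> *; exact: cst_continuous.
  by move=> i x; exact: is_derive_cst.
by move=> i j x; exact: is_derive_cst.
Qed.

Lemma jet_coord k : jet (fun x => x 0 k) (fun i _ => (i == k)%:R) (fun _ _ _ => 0).
Proof.
split=> //; try by move=> *; exact: cst_continuous.
- exact: coord_continuous.
- move=> i x.
  have dq h : h != 0 ->
      h^-1 *: ((h *: delta_mx 0 i + x) 0 k - x 0 k) = (i == k)%:R :> R.
    move=> h0; rewrite !mxE eqxx /= addrK eq_sym /GRing.scale /= mulrA mulVf //.
    by rewrite mul1r.
  have cv : (fun h : R => h^-1 *: ((h *: delta_mx 0 i + x) 0 k - x 0 k)) @ 0^'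
      --> ((i == k)%:R : R).
    apply: cvg_near_cst; near=> h; apply/dq.
    by near: h; exact: nbhs_dnbhs_neq.
  apply: DeriveDef; first by apply/cvg_ex; exists (i == k)%:R.
  exact: cvg_lim cv.
- by move=> i j x; exact: is_derive_cst.
Unshelve. all: by end_near.
Qed.

Lemma jetD f1 g1 H1 f2 g2 H2 : jet f1 g1 H1 -> jet f2 g2 H2 ->
  jet (fun x => f1 x + f2 x) (fun i x => g1 i x + g2 i x)
      (fun i j x => H1 i j x + H2 i j x).
Proof.
move=> J1 J2; split.
- move=> x; apply: (@continuousD _ _ _ f1 f2); [exact: jet_continuous J1 _|exact: jet_continuous J2 _].
- move=> i x; apply: (@continuousD _ _ _ (g1 i) (g2 i));
    [exact: jet_continuous1 J1 _ _|exact: jet_continuous1 J2 _ _].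
- move=> i j x; apply: (@continuousD _ _ _ (H1 i j) (H2 i j));
    [exact: jet_continuous2 J1 _ _ _|exact: jet_continuous2 J2 _ _ _].
- by move=> i x; apply: is_deriveD; [exact: (jet_derive1 J1)|exact: (jet_derive1 J2)].
- by move=> i j x; apply: is_deriveD; [exact: (jet_derive2 J1)|exact: (jet_derive2 J2)].
- by move=> i j x; rewrite (jet_sym J1) (jet_sym J2).
Qed.

Lemma jetM f1 g1 H1 f2 g2 H2 : jet f1 g1 H1 -> jet f2 g2 H2 ->
  jet (fun x => f1 x * f2 x) (fun i x => f1 x * g2 i x + f2 x * g1 i x)
      (fun i j x => (f1 x * H2 i j x + g2 j x * g1 i x)
                    + (f2 x * H1 i j x + g1 j x * g2 i x)).
Proof.
move=> [c1 c1' c1'' d1 d1' s1] [c2 c2' c2'' d2 d2' s2]; split.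
- by move=> x; apply: (@continuousM _ _ f1 f2); [exact: c1|exact: c2].
- move=> i x; apply: (@continuousD _ _ _ (f1 \* g2 i) (f2 \* g1 i));
    apply: continuousM; [exact: c1|exact: c2'|exact: c2|exact: c1'].
- move=> i j x; apply: (@continuousD _ _ _ (f1 \* H2 i j \+ g2 j \* g1 i)
    (f2 \* H1 i j \+ g1 j \* g2 i)); apply: continuousD; apply: continuousM;
    [exact: c1|exact: c2''|exact: c2'|exact: c1'
    |exact: c2|exact: c1''|exact: c1'|exact: c2'].
- by move=> i x; apply: is_deriveM.
- by move=> i j x; apply: is_deriveD; apply: is_deriveM.
- by move=> i j x; rewrite (s1 i j) (s2 i j); ring.
Qed.

Lemma jetZ a f g H : jet f g H ->
  jet (fun x => a * f x) (fun i x => a * g i x) (fun i j x => a * H i j x).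
Proof.
move=> J; apply: jet_ext (jetM (jet_cst a) J) _ _ _ => //.
  by move=> i x; rewrite mulr0 addr0.
by move=> i j x; rewrite !mulr0 mul0r !addr0.
Qed.

Lemma jet_sum m (f : 'I_m -> 'rV[R]_n -> R) (g : 'I_m -> 'I_n -> 'rV[R]_n -> R)
    (H : 'I_m -> 'I_n -> 'I_n -> 'rV[R]_n -> R) :
  (forall k, jet (f k) (g k) (H k)) ->
  jet (fun x => \sum_k f k x) (fun i x => \sum_k g k i x)
      (fun i j x => \sum_k H k i j x).
Proof.
elim: m f g H => [|m IH] f g H J.
  by apply: jet_ext (jet_cst 0) _ _ _ => [x|i x|i j x]; rewrite big_ord0.
apply: jet_ext (jetD (IH _ _ _ (fun k => J (widen_ord (leqnSn m) k))) (J ord_max)) _ _ _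
  => [x|i x|i j x]; by rewrite big_ord_recr.
Qed.

(** Horner induction obtains this chain rule from the sum and product rules alone; all barriers are
    such polynomial profiles. *)
Lemma jet_horner (p : {poly R}) f g H : jet f g H ->
  jet (fun x => p.[f x]) (fun i x => (deriv p).[f x] * g i x)
      (fun i j x => (deriv (deriv p)).[f x] * (g i x * g j x) + (deriv p).[f x] * H i j x).
Proof.
move=> J; elim/poly_ind: p => [|p a IH].
  by apply: jet_ext (jet_cst 0) _ _ _ => [x|i x|i j x]; rewrite ?deriv0 !horner0 ?mul0r ?addr0.
apply: jet_ext (jetD (jetM IH J) (jet_cst a)) _ _ _ => [x|i x|i j x];
  rewrite !(poly.derivE, hornerE) /=; ring.
Qed.

End jets.

(** * Horizontal gradient and Hessian in Euclidean variables *)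

Section horizontal_jets.
Context {R : realType} {d : nat}.
Notation N := (2 * d).+1.
Notation pt := 'rV[R]_N.
Implicit Types (x : pt) (k l : 'I_(2 * d)) (g : 'I_N -> R) (H : 'I_N -> 'I_N -> R).

Definition xtau x : 'rV[R]_(2 * d) := \row_k (hsign R k * 2 * x 0 (partner k)).

(* [X_k = e_k + xtau_k e_(2d+1)] are the rows of a matrix [sigma]; for g the gradient and H the
   Hessian of f, [hgrad] is [sigma g] and [hhess] is [sigma H sigma^T]. *)
Definition hgrad x g : 'rV[R]_(2 * d) :=
  \row_k (g (hidx k) + xtau x 0 k * g ord_max).

Definition hhess x H : 'M[R]_(2 * d) :=
  \matrix_(k, l) (H (hidx k) (hidx l) + xtau x 0 k * H ord_max (hidx l)
    + xtau x 0 l * (H (hidx k) ord_max + xtau x 0 k * H ord_max ord_max)).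

(* involution of the horizontal indices behind [partner] *)
Definition hpair (k : 'I_(2 * d)) : 'I_(2 * d) :=
  insubd k (if (k < d)%N then (k + d)%N else (k - d)%N).

Lemma hpair_val k : hpair k = (if (k < d)%N then (k + d)%N else (k - d)%N) :> nat.
Proof.
rewrite /hpair val_insubd; case: ifP => // /negP[].
by have := ltn_ord k; case: ifP; lia.
Qed.

Lemma hidx_val k : hidx k = k :> nat.
Proof. by rewrite /hidx inordK // ltnS ltnW. Qed.

Lemma partner_hpair k : partner k = hidx (hpair k).
Proof.
apply: val_inj; rewrite /= hidx_val hpair_val inordK //.
by have := ltn_ord k; case: ifP; lia.
Qed.

Lemma hpairK : involutive hpair.
Proof.
move=> k; apply: val_inj => /=; rewrite 2!hpair_val.
by have := ltn_ord k; case: (ltnP k d) => ? ?; case: ltnP; lia.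
Qed.

Lemma hsign_hpair k : hsign R (hpair k) = - hsign R k.
Proof.
rewrite /hsign hpair_val; have := ltn_ord k.
by case: (ltnP k d) => ? ?; case: ltnP; rewrite ?opprK //; lia.
Qed.

Lemma hsign_sqr k : hsign R k * hsign R k = 1.
Proof. by rewrite /hsign; case: ifP => _; rewrite ?mulrNN mulr1. Qed.

Lemma hidx_inj : injective (@hidx d).
Proof. by move=> k l /(congr1 val); rewrite /= !hidx_val; exact: val_inj. Qed.

Lemma hidx_neq_max k : (hidx k == ord_max) = false.
Proof. by apply/negP => /eqP /(congr1 val); rewrite /= hidx_val; have := ltn_ord k; lia. Qed.

Lemma ord_hidxP (P : 'I_N -> Prop) :
  (forall k, P (hidx k)) -> P ord_max -> forall i, P i.
Proof.
move=> Ph Pm i; have [il|il] := ltnP i (2 * d).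
  suff -> : i = hidx (Ordinal il) by [].
  by apply: val_inj; rewrite /= hidx_val.
suff -> : i = ord_max by [].
by apply: val_inj => /=; have := ltn_ord i; lia.
Qed.

Lemma sum_hidx (F : 'I_N -> R) :
  \sum_i F i = \sum_(k < 2 * d) F (hidx k) + F ord_max.
Proof.
rewrite big_ord_recr /=; congr (_ + _); apply: eq_bigr => k _; congr F.
by apply: val_inj; rewrite /= hidx_val.
Qed.

Lemma jet_C2 f (g : 'I_N -> pt -> R) (H : 'I_N -> 'I_N -> pt -> R) : jet f g H -> C2 f.
Proof.
move=> J.
have D1 i : 'D_(evec R i) f = g i.
  by apply/funext => x; exact/is_derive_val/(jet_derive1 J i x).
have D2 i j : 'D_(evec R i) (g j) = H i j.
  by apply/funext => x; exact/is_derive_val/(jet_derive2 J i j x).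
split; first exact: jet_continuous J.
split=> [i|i j]; rewrite ?D1 ?D2.
  by split=> [x|]; [have [] := jet_derive1 J i x|exact: jet_continuous1 J _].
by split=> [x|]; [have [] := jet_derive2 J i j x|exact: jet_continuous2 J _ _].
Qed.

Lemma jet_Xop f (g : 'I_N -> pt -> R) (H : 'I_N -> 'I_N -> pt -> R) k : jet f g H ->
  Xop k f = fun x => g (hidx k) x + xtau x 0 k * g ord_max x.
Proof.
move=> J; apply/funext => x; rewrite /Xop mxE.
have -> : 'D_(evec R (hidx k)) f x = g (hidx k) x.
  exact/is_derive_val/(jet_derive1 J (hidx k) x).
suff -> : 'D_(evec R ord_max) f x = g ord_max x by [].
exact/is_derive_val/(jet_derive1 J ord_max x).
Qed.

Lemma jet_DH f (g : 'I_N -> pt -> R) (H : 'I_N -> 'I_N -> pt -> R) x : jet f g H -> DH f x = hgrad x (g^~ x).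
Proof. by move=> J; apply/rowP => k; rewrite !mxE (jet_Xop k J) mxE. Qed.

(* [X_k X_l f] and [X_l X_k f] differ by a multiple of [D_t f] which is antisymmetric in (k, l). *)
Lemma jet_D2H f (g : 'I_N -> pt -> R) (H : 'I_N -> 'I_N -> pt -> R) x : jet f g H ->
  symmat (D2H f x) = hhess x (fun i j => H i j x).
Proof.
move=> J.
have XX k l : Xop k (Xop l f) x =
    H (hidx k) (hidx l) x + xtau x 0 l * H (hidx k) ord_max x
    + (l == hpair k)%:R * hsign R l * 2 * g ord_max x
    + xtau x 0 k * (H ord_max (hidx l) x + xtau x 0 l * H ord_max ord_max x).
  rewrite (jet_Xop l J) /Xop.
  have dr i : is_derive x (evec R i) (fun y => g (hidx l) y + xtau y 0 l * g ord_max y)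
      (H i (hidx l) x + (xtau x 0 l * H i ord_max x
        + g ord_max x * (hsign R l * 2 * (i == partner l)%:R))).
    apply: is_deriveD; first exact: (jet_derive2 J).
    apply: is_deriveM; last exact: (jet_derive2 J).
    have := jet_derive1 (jetZ (hsign R l * 2) (jet_coord (partner l))) i x.
    by congr is_derive; apply/funext => y; rewrite mxE.
  rewrite (is_derive_val (dr (hidx k))) (is_derive_val (dr ord_max)).
  rewrite [xtau x 0 k]mxE partner_hpair [ord_max == _]eq_sym hidx_neq_max (inj_eq (@hidx_inj)).
  rewrite (_ : (k == hpair l) = (l == hpair k)); last by rewrite -(inv_eq hpairK) eq_sym.
  by rewrite /= ?mulr0n; ring.
apply/matrixP => k l; rewrite !mxE !XX.
have E : (k == hpair l)%:R * hsign R k = - ((l == hpair k)%:R * hsign R l) :> R.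
  rewrite (_ : (k == hpair l) = (l == hpair k)); last by rewrite -(inv_eq hpairK) eq_sym.
  by case: eqP => [->|_]; rewrite ?mul0r ?oppr0 // !mul1r hsign_hpair opprK.
rewrite E (jet_sym J (hidx l)) (jet_sym J (hidx l) ord_max).
by rewrite (jet_sym J ord_max (hidx k)) !mxE; field.
Qed.

End horizontal_jets.

(** * Semicontinuous functions on compact sets *)

Section usc_compact.
Context {R : realType} {n : nat}.
Notation pt := 'rV[R]_n.
Implicit Types (v f : pt -> R) (x y z : pt) (S : set pt).

Definition usc_at v x := forall e : R, 0 < e -> \forall y \near x, v y < v x + e.

Lemma usc_atD v f x : usc_at v x -> {for x, continuous f} ->
  usc_at (fun y => v y + f y) x.
Proof.
move=> vx fx e e0; have e20 : 0 < e / 2 by rewrite divr_gt0.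
have fe : \forall y \near x, f y < f x + e / 2.
  by apply: (cvgr_lt _ fx); rewrite ltrDl.
by move: (vx _ e20) fe; apply: filterS2 => y; lra.
Qed.

(* The superlevel sets [{y in S | v x <= v y}], x in S, form a proper filter base;
   any cluster point of it is a maximum. *)
Lemma usc_compact_max v S : compact S -> S !=set0 ->
  (forall x, S x -> usc_at v x) -> exists2 x, S x & forall y, S y -> v y <= v x.
Proof.
move=> cS [x1 Sx1] vS.
pose B x := [set y | S y /\ v x <= v y].
pose F := filter_from S B.
have FF : ProperFilter F.
  apply: filter_from_proper.
    apply: filter_from_filter; first by exists x1.
    move=> i j Si Sj; have [ij|ij] := leP (v i) (v j).
      by exists j => // y [Sy vy]; do !split => //; exact: le_trans ij vy.
    by exists i => // y [Sy vy]; do !split => //; exact: le_trans (ltW ij) vy.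
  by move=> i Si; exists i; split.
have FS : F S by exists x1 => // y [].
have [x [Sx clx]] := cS F FF FS.
exists x => // y Sy; rewrite leNgt; apply/negP => vxy.
have e0 : 0 < v y - v x by rewrite subr_gt0.
have [w [[_ yw] /=]] := clx (B y) _ (ex_intro2 _ _ y Sy (fun _ => id)) (vS x Sx _ e0).
by rewrite addrC subrK ltNge yw.
Qed.

Lemma continuous_dist z : continuous (fun x => `|x - z|).
Proof.
move=> x; apply: (@continuous_comp _ _ _ (fun y => y - z) (fun y => `|y|)).
  by apply: continuousB; [exact: cvg_id|exact: cst_continuous].
exact: norm_continuous.
Qed.

(** The norm of row vectors is the sup norm, so these balls are cubes; Euclidean lengths are written
    with [dotv] and [enorm]. *)
Lemma compact_ball z (r : R) : compact [set x | `|x - z| <= r].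
Proof.
apply: bounded_closed_compact; last first.
  by have /continuous_closedP/(_ _ (@closed_le _ r)) := continuous_dist (z := z).
exists (r + `|z|); split; first exact: num_real.
move=> M rM x /= xr; rewrite -[x](subrK z) (le_trans (ler_normD _ _)) //.
by rewrite (le_trans _ (ltW rM)) // lerD2r.
Qed.

Lemma compact_sphere z (r : R) : compact [set x | `|x - z| = r].
Proof.
have -> : [set x | `|x - z| = r] = [set x | `|x - z| <= r] `&` [set x | r <= `|x - z|].
  by apply/seteqP; split=> x /=; [move=> ->|move=> [a b]; apply/eqP; rewrite eq_le a b].
apply: compact_closedI; first exact: compact_ball.
by have /continuous_closedP/(_ _ (@closed_ge _ r)) := continuous_dist (z := z).
Qed.

Lemma near_norm_lt x (P : pt -> Prop) :
  (\forall y \near x, P y) <-> exists2 e : R, 0 < e & forall y, `|y - x| < e -> P y.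
Proof.
split=> [/nbhs_normP[e /= e0 He]|[e e0 He]].
  by exists e => // y yx; apply: He; rewrite /= distrC.
by apply/nbhs_normP; exists e => // y /=; rewrite distrC => /He.
Qed.

End usc_compact.

(** The derivatives stay existential because only continuity is extracted from it. *)
Definition smooth {R : realType} {n} (f : 'rV[R]_n -> R) := exists g H, jet f g H.

Section smooth.
Context {R : realType} {n : nat}.
Implicit Types f : 'rV[R]_n -> R.

Lemma smooth_continuous f : smooth f -> continuous f.
Proof. by move=> [g [H J]]; exact: jet_continuous J. Qed.

Lemma smooth_cst (a : R) : smooth (fun _ : 'rV[R]_n => a).
Proof. by do 2 eexists; exact: jet_cst. Qed.

Lemma smooth_coord i : smooth (fun x : 'rV[R]_n => x 0 i).
Proof. by do 2 eexists; exact: jet_coord. Qed.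

Lemma smoothD f1 f2 : smooth f1 -> smooth f2 -> smooth (fun x => f1 x + f2 x).
Proof. by move=> [? [? J1]] [? [? J2]]; do 2 eexists; exact: jetD J1 J2. Qed.

Lemma smoothM f1 f2 : smooth f1 -> smooth f2 -> smooth (fun x => f1 x * f2 x).
Proof. by move=> [? [? J1]] [? [? J2]]; do 2 eexists; exact: jetM J1 J2. Qed.

Lemma smooth_sum m (f : 'I_m -> 'rV[R]_n -> R) :
  (forall k, smooth (f k)) -> smooth (fun x => \sum_k f k x).
Proof.
move=> fs; have [g gP] := choice fs; have [H HP] := choice gP.
by do 2 eexists; exact: jet_sum HP.
Qed.

End smooth.

(** * Viscosity inequalities without inf and sup *)

Section viscosity_jets.
Context {R : realType} {d : nat}.
Notation N := (2 * d).+1.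
Notation pt := 'rV[R]_N.
Context (lam Lam : R) (A : Type) (b : A -> pt -> 'rV[R]_(2 * d)).
Context (lam_le : lam <= Lam).

(* The common content of both halves of the theorem, free of inf and sup:
   [zo a x] stands for the zeroth order term [c a x * u x], tests are made where [D] holds. *)
Definition jet_subsol (zo : A -> pt -> R) (D : pt -> Prop) (v : pt -> R) : Prop :=
  forall f g H x, jet f g H -> D x -> (\forall y \near x, v y - f y <= v x - f x) ->
  forall p q : R,
    (forall Am, pucci_adm lam Lam Am -> p <= - \tr (Am *m hhess x (fun i j => H i j x))) ->
    (forall a, q <= zo a x - dotv (b a x) (hgrad x (g^~ x))) ->
  p + q <= 0.

(** A common lower bound of a nonempty family bounds its infimum from below. Nonemptiness is
    witnessed by [lam%:M] among the admissible matrices and by [a0] in the index set. *)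
Lemma visc_sub_jet (c : A -> pt -> R) (u : pt -> R) : inhabited A ->
  visc_sub (fun x r p X => pucci_minus lam Lam X + Hinf b c x r p) u ->
  jet_subsol (fun a x => c a x * u x) (fun=> True) u.
Proof.
move=> [a0] vs f g H x J _ mx p q hp hq.
have := vs f x (jet_C2 J) mx; rewrite (jet_DH _ J) (jet_D2H _ J).
apply: le_trans; apply: lerD; apply: lb_le_inf.
- by eexists; exists lam%:M; [exact: pucci_adm_scalar|].
- by move=> _ [Am hA <-]; rewrite linearN; exact: hp.
- by eexists; exists a0.
- by move=> _ [a _ <-]; exact: hq.
Qed.

(** Negation exchanges the operators: [M^+(-X) = - M^-(X)] and [H_s(x,-r,-p) = - H_i(x,r,p)]. A
    function touching [- v] from above becomes, after negation, one touching [v] from below. *)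
Lemma visc_super_jet (c : A -> pt -> R) (v : pt -> R) : inhabited A ->
  visc_super (fun x r p X => pucci_plus lam Lam X + Hsup b c x r p) v ->
  jet_subsol (fun a x => c a x * - v x) (fun=> True) (fun x => - v x).
Proof.
move=> [a0] vs f g H x J _ mx p q hp hq.
have J' := jetZ (-1) J.
have mx' : \forall y \near x, v x - -1 * f x <= v y - -1 * f y.
  by move: mx; apply: filterS => y; lra.
have := vs _ x (jet_C2 J') mx'; rewrite (jet_DH _ J') (jet_D2H _ J').
rewrite -oppr_le0; apply: le_trans; rewrite opprD; apply: lerD; rewrite lerNr.
- apply: ge_sup; first by eexists; exists lam%:M; [exact: pucci_adm_scalar|].
  move=> _ [Am hA <-]; rewrite lerNr; apply: le_trans (hp _ hA) _.
  rewrite linearN opprK /= -raddfN -mulmxN le_eqVlt; apply/orP; left; apply/eqP.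
  by congr (\tr (_ *m _)); apply/matrixP => k l; rewrite !mxE; ring.
- apply: ge_sup; first by eexists; exists a0.
  move=> _ [a _ <-]; rewrite lerNr; apply: le_trans (hq a) _.
  rewrite mulrN opprB addrC; have -> : hgrad x (fun i => -1 * g i x) = -1 *: hgrad x (g^~ x).
    by apply/rowP => k; rewrite !mxE; ring.
  by rewrite dotvZr mulN1r.
Qed.

End viscosity_jets.

(** * Quadratic barriers and the Hopf lemma *)

Section paraboloid.
Context {R : realType} {n : nat}.
Implicit Types (x z nv : 'rV[R]_n).

Lemma sum_delta (F : 'I_n -> R) i : \sum_k (i == k)%:R * F k = F i.
Proof.
rewrite (bigD1 i) //= big1 => [|k /negbTE ki]; first by rewrite eqxx mul1r addr0.
by rewrite eq_sym ki mul0r.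
Qed.

(* Positive exactly in the open ball with diameter [z, z + nv]. *)
Definition bump z nv x : R := dotv (x - z) nv - dotv (x - z) (x - z).

Definition bump1 z nv (i : 'I_n) x : R := nv 0 i - 2 * (x 0 i - z 0 i).

Lemma jet_bump z nv :
  jet (bump z nv) (bump1 z nv) (fun i j _ => - 2 * (i == j)%:R).
Proof.
have J k := jetD (jet_coord k) (jet_cst (- z 0 k)).
have Jk k := jetD (jetZ (nv 0 k) (J k)) (jetZ (-1) (jetM (J k) (J k))).
apply: jet_ext (jet_sum Jk) _ _ _ => [x|i x|i j x].
- rewrite /bump /dotv -sumrB; apply: eq_bigr => k _; rewrite !mxE; ring.
- rewrite -[RHS](sum_delta (fun k => bump1 z nv k x)); apply: eq_bigr => k _.
  by rewrite /bump1; ring.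
- transitivity (\sum_k (i == k)%:R * ((j == k)%:R * - 2 : R)).
    by apply: eq_bigr => k _; ring.
  by rewrite sum_delta eq_sym mulrC.
Qed.

Lemma bump0 z nv : bump z nv z = 0.
Proof. by rewrite /bump subrr /dotv !big1 ?subrr // => i _; rewrite !mxE mul0r. Qed.

End paraboloid.

Section hopf.
Context {R : realType} {d : nat}.
Notation N := (2 * d).+1.
Notation pt := 'rV[R]_N.
Implicit Types (x z : pt) (w : 'I_N -> R).

(** Functions of a paraboloid have Hessians of this form. The factor of [s] is [sigma sigma^T]: the
    [e_k] are orthonormal and orthogonal to [e_(2d+1)]. *)
Lemma hhess_quad x w (s t : R) :
  hhess x (fun i j => s * (i == j)%:R + t * (w i * w j)) =
  s *: (1%:M + (xtau x)^T *m xtau x) + t *: ((hgrad x w)^T *m hgrad x w).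
Proof.
apply/matrixP => k l; rewrite [LHS]mxE !mxE !big_ord1 !mxE.
rewrite (inj_eq (@hidx_inj d)) [ord_max == _]eq_sym !hidx_neq_max eqxx /=.
by ring.
Qed.

Lemma smooth_xtau k : smooth (fun x : pt => xtau x 0 k).
Proof.
rewrite (_ : (fun _ => _) = fun x => hsign R k * 2 * x 0 (partner k)).
  by apply: smoothM; [exact: smooth_cst|exact: smooth_coord].
by apply/funext => x; rewrite mxE.
Qed.

Lemma smooth_hgrad (w : 'I_N -> pt -> R) k : (forall i, smooth (w i)) ->
  smooth (fun x => hgrad x (w^~ x) 0 k).
Proof.
move=> ws; rewrite (_ : (fun _ => _) =
    fun x => w (hidx k) x + xtau x 0 k * w ord_max x).
  by apply: smoothD => //; apply: smoothM => //; exact: smooth_xtau.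
by apply/funext => x; rewrite mxE.
Qed.

Lemma smooth_dotv m (F G : pt -> 'rV[R]_m) :
  (forall k, smooth (fun x => F x 0 k)) -> (forall k, smooth (fun x => G x 0 k)) ->
  smooth (fun x => dotv (F x) (G x)).
Proof. by move=> Fs Gs; apply: smooth_sum => k; apply: smoothM. Qed.

Lemma smooth_bump1 z nv i : smooth (bump1 z nv i).
Proof.
apply: smoothD; first exact: smooth_cst.
rewrite (_ : (fun _ => _) = fun x : pt => -2 * (x 0 i + - z 0 i)).
  apply: smoothM; first exact: smooth_cst.
  by apply: smoothD; [exact: smooth_coord|exact: smooth_cst].
by apply/funext => x; rewrite mulNr.
Qed.

Lemma hgrad_bump1 z nv : hgrad z (fun i => bump1 z nv i z) = hgrad z (nv 0).
Proof. by apply/rowP => k; rewrite !mxE /bump1 !subrr mulr0 !subr0. Qed.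

Context (lam Lam : R) (A : Type) (b : A -> pt -> 'rV[R]_(2 * d)).
Context (lam_gt0 : 0 < lam) (lam_le : lam <= Lam).

(* Where [2 ga |bump| <= 1/2] and the horizontal gradient of [bump] is at least [a / 2],
   a large [ga] makes [- del (bump + ga bump^2)] a strict supersolution. *)
Lemma bump_test (v : pt -> R) (D : pt -> Prop) z nv (ga del a T B : R) x :
  jet_subsol lam Lam b (fun _ _ => 0) D v -> D x ->
  0 < ga -> 0 < del -> 0 <= B ->
  (forall al k, `|b al x 0 k| <= B) ->
  dotv (xtau x) (xtau x) <= T ->
  a / 2 <= dotv (hgrad x (fun i => bump1 z nv i x)) (hgrad x (fun i => bump1 z nv i x)) <= a + 1 ->
  2 * ga * `|bump z nv x| <= 2^-1 ->
  3 * (Lam * ((2 * d)%:R + T)) + 2 * (B * ((2 * d)%:R + a + 1)) < ga * lam * a ->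
  ~ (\forall y \near x, v y + del * (bump z nv y + ga * bump z nv y ^+ 2)
                        <= v x + del * (bump z nv x + ga * bump z nv x ^+ 2)).
Proof.
move=> vsub Dx ga0 del0 B0 bB hT /andP[pa pa1] hq hga mx.
pose P : {poly R} := (- del) *: ('X + ga *: 'X^2).
have J := jet_horner P (jet_bump z nv).
have PE t : P.[t] = - del * (t + ga * t ^+ 2) by rewrite /P !hornerE.
have P1 t : (deriv P).[t] = - del * (1 + 2 * ga * t).
  by rewrite /P !(poly.derivE, hornerE) /=; ring.
have P2 t : (deriv (deriv P)).[t] = - del * (2 * ga).
  by rewrite /P !(poly.derivE, hornerE) /=; ring.
set q := bump z nv x in hq.
set p := hgrad x _ in pa pa1.
have [q1 q2] : 2^-1 <= 1 + 2 * ga * q /\ 1 + 2 * ga * q <= 3 / 2.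
  have : `|2 * ga * q| <= 2^-1 by rewrite normrM gtr0_norm ?mulr_gt0.
  by rewrite ler_norml => /andP[]; split; lra.
set s := 1 + 2 * ga * q in q1 q2.
have mx' : \forall y \near x, v y - P.[bump z nv y] <= v x - P.[bump z nv x].
  by move: mx; apply: filterS => y; rewrite !PE; lra.
have Lam0 : 0 <= Lam by rewrite (le_trans _ lam_le) // ltW.
have key : forall al, - (del * (3 / 2 * (B * ((2 * d)%:R + a + 1)))) <=
    0 - dotv (b al x) (hgrad x (fun i => (deriv P).[q] * bump1 z nv i x)).
  move=> al; rewrite sub0r lerN2.
  have -> : hgrad x (fun i => (deriv P).[q] * bump1 z nv i x) = (deriv P).[q] *: p.
    by apply/rowP => k; rewrite /p !mxE; ring.
  (* [|p_k| <= 1 + p_k^2] avoids square roots; summing over k gives the factor [2d + a + 1]. *)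
  have pB k : `|b al x 0 k * p 0 k| <= B * (1 + p 0 k * p 0 k).
    rewrite normrM ler_pM //.
    have := sqr_ge0 (`|p 0 k| - 1).
    have : `|p 0 k| * `|p 0 k| = p 0 k * p 0 k by rewrite -normrM ger0_norm // -expr2 sqr_ge0.
    have := normr_ge0 (p 0 k); nra.
  have bp : `|dotv (b al x) p| <= B * ((2 * d)%:R + a + 1).
    apply: le_trans (ler_norm_sum _ _ _) _.
    apply: le_trans (ler_sum _ (fun k _ => pB k)) _.
    rewrite -mulr_sumr ler_wpM2l // big_split /= sumr_const card_ord -addrA lerD2l.
    exact: pa1.
  rewrite dotvZr P1 -/s.
  have := ler_norm (- dotv (b al x) p); rewrite normrN => bp'.
  have : s * (- dotv (b al x) p) <= 3 / 2 * (B * ((2 * d)%:R + a + 1)).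
    have bp2 := le_trans bp' bp; have s0 : 0 <= s by lra.
    apply: le_trans (ler_wpM2l s0 bp2) _; apply: ler_wpM2r => //.
    exact: le_trans (normr_ge0 _) bp.
  by move=> /(ler_wpM2l (ltW del0)); lra.
(* The slope of the profile gives [2 del s sigma sigma^T], with [s <= 3/2], a loss of at most
   [3 del Lam (2d + T)]. Its curvature gives [- 2 del ga p^T p], by ellipticity a gain of at least
   [del ga lam a]. *)
have hH : forall Am, pucci_adm lam Lam Am ->
    del * (ga * lam * a - 3 * (Lam * ((2 * d)%:R + T))) <=
    - \tr (Am *m hhess x (fun i j => (deriv (deriv P)).[q] * (bump1 z nv i x * bump1 z nv j x)
             + (deriv P).[q] * (- 2 * (i == j)%:R))).
  move=> Am hA.
  have -> : (fun i j : 'I_N => (deriv (deriv P)).[q] * (bump1 z nv i x * bump1 z nv j x)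
             + (deriv P).[q] * (- 2 * (i == j)%:R)) =
     (fun i j => (2 * del * s) * (i == j)%:R
          + (- del * (2 * ga)) * (bump1 z nv i x * bump1 z nv j x)).
    by apply/funext => i; apply/funext => j; rewrite P1 P2 -/s; ring.
  rewrite hhess_quad -/p mulmxDr -!scalemxAr mulmxDr mulmx1 mxtraceD !mxtraceZ mxtraceD.
  rewrite !mxtrace_mul_outer.
  have tA := trace_pucci_adm_le hA.
  have [_ hA'] := hA.
  have /andP[_ tT] := hA' (xtau x); have /andP[tp _] := hA' p.
  have tT' : dotv (xtau x *m Am) (xtau x) <= Lam * T.
    by rewrite (le_trans tT) // ler_wpM2l.
  have tp' : lam * (a / 2) <= dotv (p *m Am) p by rewrite (le_trans _ tp) // ler_pM2l.
  have t1 : s * (\tr Am + dotv (xtau x *m Am) (xtau x)) <= 3 / 2 * (Lam * ((2 * d)%:R + T)).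
    apply: (@le_trans _ _ (s * (Lam * ((2 * d)%:R + T)))).
      by rewrite ler_wpM2l //; lra.
    rewrite ler_wpM2r //; rewrite mulr_ge0 // addr_ge0 //.
    by rewrite (le_trans _ hT) // dotv_ge0.
  have t2 : ga * (lam * (a / 2)) <= ga * dotv (p *m Am) p by rewrite ler_pM2l.
  have := ler_wpM2l (ltW del0) t1; have := ler_wpM2l (ltW del0) t2. lra.
have := vsub _ _ _ x J Dx mx' _ _ hH key.
have : 0 < del * (ga * lam * a - 3 * (Lam * ((2 * d)%:R + T))
   - 2 * (B * ((2 * d)%:R + a + 1))) by rewrite mulr_gt0 //; lra.
have : 0 <= del * (B * ((2 * d)%:R + a + 1)).
  apply: mulr_ge0 (ltW del0) (mulr_ge0 B0 _).
  by rewrite -addrA addr_ge0 // (le_trans (dotv_ge0 p)).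
lra.
Qed.

(** If the horizontal part of [nv] were nonzero, consider [v + del W] with [W = bump + ga bump^2] on
    a small cube. It equals m at z and is below m on the boundary: where [bump >= 0] because v stays
    away from m, where [bump < 0] because [W < 0]. Its maximum is then interior, against
    [bump_test]. There [del W < kap], which is why testing where [v > m - kap] suffices. *)
Lemma hopf (v : pt -> R) z nv (m kap r B : R) :
  0 < kap -> 0 < r -> 0 <= B ->
  (forall x, `|x - z| < r -> forall al k, `|b al x 0 k| <= B) ->
  jet_subsol lam Lam b (fun _ _ => 0) (fun x => m - kap < v x /\ `|x - z| < r) v ->
  v z = m -> (forall x, `|x - z| < r -> v x <= m) ->
  (forall x, `|x - z| < r -> usc_at v x) ->
  (forall x, `|x - z| < r -> x != z -> 0 <= bump z nv x -> v x < m) ->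
  hgrad z (nv 0) = 0.
Proof.
move=> kap0 r0 B0 bB vsub vz vm vusc vlt; apply/eqP; rewrite -dotv_eq0.
apply/negPn/negP => an0.
pose p x := hgrad x (fun i => bump1 z nv i x).
have pz : p z = hgrad z (nv 0) by exact: hgrad_bump1.
set a := dotv _ _ in an0.
have a0 : 0 < a by rewrite lt_neqAle eq_sym an0 dotv_ge0.
pose T := dotv (xtau z) (xtau z) + 1.
have p_cont : continuous (fun x => dotv (p x) (p x)).
  apply: smooth_continuous; apply: smooth_dotv => k;
    by apply: smooth_hgrad => i; exact: smooth_bump1.
have t_cont : continuous (fun x => dotv (xtau x : 'rV[R]_(2 * d)) (xtau x)).
  by apply: smooth_continuous; apply: smooth_dotv => k; exact: smooth_xtau.
have q_cont : continuous (bump z nv).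
  by apply: smooth_continuous; do 2 eexists; exact: jet_bump.
pose C := 3 * (Lam * ((2 * d)%:R + T)) + 2 * (B * ((2 * d)%:R + a + 1)).
pose ga := (`|C| + 1) / (lam * a).
have ga0 : 0 < ga by rewrite divr_gt0 ?mulr_gt0 // ltr_wpDl.
have gaC : C < ga * lam * a.
  rewrite -mulrA divfK ?gt_eqF ?mulr_gt0 //.
  by rewrite (le_lt_trans (ler_norm C)) // ltrDl.
(* The bound on [bump] gives [|ga bump| < 1/4]; hence W has the sign of [bump], and
   [|W| <= 1/(2 ga)]. *)
have : \forall x \near z, [/\ a / 2 < dotv (p x) (p x), dotv (p x) (p x) < a + 1,
   dotv (xtau x : 'rV[R]_(2 * d)) (xtau x) < T & `|bump z nv x| < (4 * ga)^-1].
  have n1 : \forall x \near z, a / 2 < dotv (p x) (p x).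
    by apply: (cvgr_gt _ (p_cont z)); rewrite pz -/a; lra.
  have n2 : \forall x \near z, dotv (p x) (p x) < a + 1.
    by apply: (cvgr_lt _ (p_cont z)); rewrite pz -/a; lra.
  have n3 : \forall x \near z, dotv (xtau x : 'rV[R]_(2 * d)) (xtau x) < T.
    by apply: (cvgr_lt _ (t_cont z)); rewrite ltrDl.
  have n4 : \forall x \near z, `|bump z nv x| < (4 * ga)^-1.
    have g40 : 0 < (4 * ga)^-1 by rewrite invr_gt0 mulr_gt0.
    have /cvgr_dist_lt/(_ _ g40) := q_cont z.
    by rewrite bump0; apply: filterS => x; rewrite sub0r normrN.
  by near=> x; split; near: x.
move=> /near_norm_lt[e e0 He].
pose e' := Num.min e r / 2.
have er0 : 0 < Num.min e r by rewrite lt_min e0 r0.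
have e'0 : 0 < e' by rewrite divr_gt0.
have e'e x : `|x - z| <= e' -> `|x - z| < e /\ `|x - z| < r.
  move=> xe; have : `|x - z| < Num.min e r by rewrite /e' in xe; lra.
  by rewrite lt_min => /andP.
pose W x := bump z nv x + ga * bump z nv x ^+ 2.
have W_le x : `|x - z| <= e' -> `|W x| <= (2 * ga)^-1.
  move=> /e'e[/He[_ _ _ qx] _].
  have -> : W x = bump z nv x * (1 + ga * bump z nv x) by rewrite /W; ring.
  have : ga * `|bump z nv x| < 4^-1.
    by rewrite -ltr_pdivlMl // -invfM mulrC.
  have : `|1 + ga * bump z nv x| <= 1 + ga * `|bump z nv x|.
    by rewrite (le_trans (ler_normD _ _)) // normr1 normrM (gtr0_norm ga0).
  move=> h1 h2; rewrite normrM.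
  have -> : (2 * ga)^-1 = (4 * ga)^-1 * 2 by field; rewrite gt_eqF.
  by rewrite ler_pM // ?(ltW qx) //; lra.
(* On this compact part of the boundary v attains a maximum below m; [kap1] is the gap, or 1 if the
   part is empty. *)
have [kap1 kap10 vkap1] : exists2 kap1 : R, 0 < kap1 &
    forall x, `|x - z| = e' -> 0 <= bump z nv x -> v x <= m - kap1.
  pose S := [set x | `|x - z| = e'] `&` [set x | 0 <= bump z nv x].
  have cS : compact S.
    apply: compact_closedI; first exact: compact_sphere.
    by have /continuous_closedP/(_ _ (@closed_ge _ 0)) := q_cont.
  have S_usc x : S x -> usc_at v x by move=> [xe _]; apply: vusc; apply: (e'e x _).2; rewrite xe.
  have [S0|S0] := pselect (S !=set0); last first.
    by exists 1 => // x xe qx; exfalso; apply: S0; exists x.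
  have [y [ye qy] ymax] := usc_compact_max cS S0 S_usc.
  exists (m - v y) => [|x xe qx]; last by rewrite opprB addrC subrK; apply: ymax; split.
  rewrite subr_gt0; apply: vlt => //; first by apply: (e'e y _).2; rewrite ye.
  by apply: contraTneq e'0 => yz; rewrite -ye yz subrr normr0 ltxx.
pose mk := Num.min kap kap1.
have mk0 : 0 < mk by rewrite lt_min kap0 kap10.
(* With [|W| <= 1/(2 ga)] this makes [del W <= mk / 2], smaller than both [kap] and [kap1]. *)
pose del := ga * mk.
have del0 : 0 < del by rewrite mulr_gt0.
have dW x : `|x - z| <= e' -> del * W x <= mk / 2.
  move=> /W_le Wx; apply: le_trans (ler_norm _) _; rewrite normrM (gtr0_norm del0).
  apply: le_trans (ler_wpM2l (ltW del0) Wx) _.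
  by rewrite /del le_eqVlt; apply/orP; left; apply/eqP; field; rewrite gt_eqF.
have Wz : W z = 0 by rewrite /W bump0; ring.
have W_cont : continuous (fun x => del * W x).
  apply: smooth_continuous; apply: smoothM; first exact: smooth_cst.
  have qs : smooth (bump z nv) by do 2 eexists; exact: jet_bump.
  apply: smoothD => //; apply: smoothM; first exact: smooth_cst.
  by rewrite (_ : (fun _ => _) = fun x => bump z nv x * bump z nv x) //; exact: smoothM.
pose S := [set x | `|x - z| <= e'].
have Sz : S z by rewrite /S /= subrr normr0 ltW.
have S_usc x : S x -> usc_at (fun y => v y + del * W y) x.
  by move=> /e'e[_ xr]; apply: usc_atD; [exact: vusc|exact: W_cont].
have [x0 Sx0 x0max] := usc_compact_max (compact_ball (z := z) (r := e')) (ex_intro _ z Sz) S_usc.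
have x0m : m <= v x0 + del * W x0 by have := x0max z Sz; rewrite Wz mulr0 addr0 vz.
have [x0e x0r] := e'e _ Sx0; have [pa pa1 tT qe] := He _ x0e.
have g4 : 2 * ga * `|bump z nv x0| <= 2^-1.
  have -> : 2^-1 = 2 * ga * (4 * ga)^-1 by field; rewrite gt_eqF.
  by apply: ler_wpM2l; [apply/ltW/mulr_gt0|exact: ltW].
have x0in : `|x0 - z| < e'.
  rewrite lt_neqAle Sx0 andbT; apply/negP => /eqP x0S.
  have [q0|q0] := leP 0 (bump z nv x0).
    have := vkap1 _ x0S q0; have := dW _ Sx0.
    have : mk <= kap1 by rewrite ge_min lexx orbT.
    lra.
  have W0 : W x0 < 0.
    rewrite (_ : W x0 = bump z nv x0 * (1 + ga * bump z nv x0)); last by rewrite /W; ring.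
    rewrite nmulr_rlt0 //; move: g4; rewrite ltr0_norm //; lra.
  have := vm _ x0r; have : del * W x0 < 0 by rewrite pmulr_rlt0.
  lra.
have Dx0 : m - kap < v x0 /\ `|x0 - z| < r.
  split=> //; have := dW _ Sx0.
  have : mk <= kap by rewrite ge_min lexx.
  lra.
apply: (bump_test vsub Dx0 ga0 del0 B0 (bB _ x0r) (ltW tT) _ g4 gaC); first by rewrite !ltW.
apply/near_norm_lt; exists (e' - `|x0 - z|); first by rewrite subr_gt0.
move=> y ye; apply: x0max; rewrite /S /= -(subrK x0 y) -addrA.
by rewrite (le_trans (ler_normD _ _)) // -lerBrDr ltW.
Unshelve. all: by end_near.
Qed.

End hopf.

(** * Nearest points and invariance under the horizontal flows *)

Lemma normr_sqr_le_dotv {R : realType} n (x : 'rV[R]_n) : `|x| ^+ 2 <= dotv x x.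
Proof.
have [->|x0] := eqVneq x 0; first by rewrite normr0 expr0n /= dotv_ge0.
have : mx_norm x != 0 by rewrite -[mx_norm x]/`|x| normr_eq0.
move=> /mx_norm_neq0[[i j] /=]; rewrite -[mx_norm x]/`|x| => ->.
rewrite ord1 real_normK ?num_real // /dotv (bigD1 j) //= -expr2 lerDl.
by apply: sumr_ge0 => k _; rewrite -expr2 sqr_ge0.
Qed.

Lemma dotv_addZ {R : realType} n (v w : 'rV[R]_n) h :
  dotv (v + h *: w) (v + h *: w) = dotv v v + h * (2 * dotv v w) + h ^+ 2 * dotv w w.
Proof. by rewrite dotvDl !dotvDr !dotvZl !dotvZr (dotvC w); ring. Qed.

Lemma closed_superlevel {R : realType} n (v : 'rV[R]_n -> R) m :
  (forall x, usc_at v x) -> closed [set x | m <= v x].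
Proof.
move=> vu; rewrite -openC openE => x /= /negP; rewrite -ltNge => vm.
have e0 : 0 < m - v x by rewrite subr_gt0.
by move: (vu x _ e0); apply: filterS => y; rewrite addrC subrK => vy; apply/negP; rewrite -ltNge.
Qed.

Lemma nearest_point {R : realType} n (K : set 'rV[R]_n) y : closed K -> K !=set0 ->
  exists2 z, K z & forall w, K w -> dotv (y - z) (y - z) <= dotv (y - w) (y - w).
Proof.
move=> cK [z0 Kz0].
pose D := dotv (y - z0) (y - z0).
have D0 : 0 <= D by exact: dotv_ge0.
(* Since [(1 + D)^2 > D], points outside the cube of radius [1 + D] are farther from y than [z0],
   and the minimum may be sought on a compact part of K. *)
have big w : 1 + D < `|w - y| -> D < dotv (y - w) (y - w).
  rewrite distrC => wy; apply: lt_le_trans (normr_sqr_le_dotv _).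
  by rewrite expr2; nra.
pose S := [set x | `|x - y| <= 1 + D] `&` K.
have cS : compact S by apply: compact_closedI => //; exact: compact_ball.
have Sz0 : S z0.
  by split=> //=; rewrite leNgt; apply/negP => /big; rewrite -/D ltxx.
pose f (w : 'rV[R]_n) : R := - dotv (y - w) (y - w).
have f_usc x : S x -> usc_at f x.
  move=> _ e e0; have fs : smooth f.
    rewrite (_ : f = fun x => -1 * dotv (y - x) (y - x)); last first.
      by apply/funext => w; rewrite mulN1r.
    apply: smoothM; first exact: smooth_cst.
    apply: smooth_sum => k; rewrite (_ : (fun _ => _) =
      fun w : 'rV[R]_n => (y 0 k + -1 * w 0 k) * (y 0 k + -1 * w 0 k)).
      by apply: smoothM; (apply: smoothD; first exact: smooth_cst);
        (apply: smoothM; [exact: smooth_cst|exact: smooth_coord]).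
    by apply/funext => w; rewrite !mxE mulN1r.
  have fc := smooth_continuous fs.
  by apply: (cvgr_lt _ (fc x)); rewrite ltrDl.
have [z [zy Kz] zmax] := usc_compact_max cS (ex_intro _ z0 Sz0) f_usc.
exists z => // w Kw; have [wy|wy] := leP `|w - y| (1 + D).
  by rewrite -lerN2; apply: zmax.
apply: le_trans (ltW (big _ wy)).
by rewrite -lerN2; exact: (zmax z0).
Qed.

Section propagation.
Context {R : realType} {d : nat}.
Notation N := (2 * d).+1.
Notation pt := 'rV[R]_N.
Implicit Types (x y z : pt).

Definition hfield (k : 'I_(2 * d)) x : pt :=
  evec R (hidx k) + xtau x 0 k *: evec R ord_max.

(** This is the exact flow of [X_k]: the coefficient depends only on the partner coordinate, which
    is constant along [X_k], so integral curves are straight lines. *)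
Definition hflow k (a : R) x : pt := x + a *: hfield k x.

Lemma dotv_evec x (j : 'I_N) : dotv x (evec R j) = x 0 j.
Proof.
rewrite /dotv -[RHS](sum_delta (fun k => x 0 k)); apply: eq_bigr => k _.
by rewrite /evec mxE eqxx mulrC (eq_sym k).
Qed.

Lemma dotv_hfield x k z : dotv x (hfield k z) = hgrad z (x 0) 0 k.
Proof. by rewrite dotvDr dotvZr !dotv_evec !mxE. Qed.

Lemma hflowE k a x (j : 'I_N) : hflow k a x 0 j =
  x 0 j + a * ((j == hidx k)%:R + xtau x 0 k * (j == ord_max)%:R).
Proof. by rewrite !mxE eqxx. Qed.

Lemma hpair_neq (k : 'I_(2 * d)) : (hpair k == k) = false.
Proof.
apply/negP => /eqP/(congr1 val); rewrite /= hpair_val.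
by have := ltn_ord k; case: ifP; lia.
Qed.

Lemma hflow_partner k a x : hflow k a x 0 (partner k) = x 0 (partner k).
Proof.
rewrite hflowE partner_hpair (inj_eq (@hidx_inj d)) hpair_neq hidx_neq_max /=.
by rewrite mulr0 addr0 mulr0 addr0.
Qed.

Lemma hfield_flow k a x : hfield k (hflow k a x) = hfield k x.
Proof.
rewrite /hfield; congr (_ + _ *: _).
by rewrite [LHS]mxE [RHS]mxE hflow_partner.
Qed.

(* Brezis-Bony invariance along a line: with [E_j] the squared distance to [K] after [j] steps
   of length [h], orthogonality to the proximal normals gives
   [E_(j+1) <= (1 + 2 |h|) E_j + C h^2]. *)
Lemma flow_near (K : set pt) k x (h : R) (j : nat) :
  closed K -> K x ->
  (forall y z, K z -> (forall w, K w -> dotv (y - z) (y - z) <= dotv (y - w) (y - w)) ->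
    hgrad z ((y - z) 0) = 0) ->
  exists2 z, K z & dotv (hflow k (j%:R * h) x - z) (hflow k (j%:R * h) x - z)
     <= j%:R * dotv (hfield k x) (hfield k x) * h ^+ 2 * (1 + 2 * `|h|) ^+ j.
Proof.
move=> cK Kx Kn; set C := dotv (hfield k x) _.
have C0 : 0 <= C by exact: dotv_ge0.
elim: j => [|j [zj Kzj Ej]].
  exists x => //; rewrite /hflow mul0r scale0r addr0 subrr !mul0r.
  by have /eqP -> : dotv (0 : pt) 0 == 0 by rewrite dotv_eq0.
set y := hflow k (j%:R * h) x in Ej.
have [z Kz zmin] := nearest_point y cK (ex_intro _ x Kx).
exists z => //; set n := y - z.
have -> : hflow k (j.+1%:R * h) x - z = n + h *: hfield k x.
  by apply/rowP => i; rewrite /n /y /hflow !mxE -natr1; ring.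
have nE := le_trans (zmin _ Kzj) Ej; rewrite -/n in nE.
(* The proximal normal n is orthogonal to [X_k] at z, so only [X_k(y) - X_k(z)] counts. This
   difference is vertical and linear in n, whence [n . X_k(y)] is quadratic in n. *)
have nX : `|2 * dotv n (hfield k x)| <= 2 * dotv n n.
  have n0 := Kn y z Kz zmin; rewrite -/n in n0.
  have -> : dotv n (hfield k x) = hsign R k * (2 * (n 0 (partner k) * n 0 ord_max)).
    have := dotv_hfield n k z; rewrite n0 [in RHS]mxE => nz.
    rewrite -[LHS]subr0 -nz -(hfield_flow k (j%:R * h) x) -/y.
    rewrite !dotvDr !dotvZr !dotv_evec /n !mxE; ring.
  have hs : `|hsign R k| = 1 by rewrite /hsign; case: ifP; rewrite ?normrN normr1.
  rewrite mulrCA normrM hs mul1r normrM ger0_norm // ler_pM2l //.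
  have -> : dotv n n = \sum_i n 0 i ^+ 2 by apply: eq_bigr => i _; rewrite expr2.
  have pm : partner k != ord_max by rewrite partner_hpair hidx_neq_max.
  rewrite (bigD1 ord_max) //= (bigD1 (partner k)) //= addrA.
  apply: (@le_trans _ _ (n 0 ord_max ^+ 2 + n 0 (partner k) ^+ 2)).
    rewrite ler_norml; have := sqr_ge0 (n 0 ord_max - n 0 (partner k)).
    by have := sqr_ge0 (n 0 ord_max + n 0 (partner k)); rewrite !expr2; lra.
  by rewrite lerDl; apply: sumr_ge0 => i _; exact: sqr_ge0.
rewrite dotv_addZ -/C.
have hX : h * (2 * dotv n (hfield k x)) <= `|h| * (2 * dotv n n).
  apply: le_trans (ler_norm _) _; rewrite normrM.
  exact: ler_wpM2l.
set F := 1 + 2 * `|h|; have F1 : 1 <= F by rewrite lerDl mulr_ge0.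
apply: (@le_trans _ _ (F * dotv n n + C * h ^+ 2)); first by rewrite /F; lra.
have Fj : 1 <= F ^+ j.+1 by exact: exprn_ege1.
have h2 : 0 <= C * h ^+ 2 by rewrite mulr_ge0 // sqr_ge0.
apply: (@le_trans _ _ (F * (j%:R * C * h ^+ 2 * F ^+ j) + C * h ^+ 2 * F ^+ j.+1)).
  by apply: lerD; [apply: ler_wpM2l nE; exact: le_trans F1|rewrite ler_peMr].
by rewrite -natr1 [F ^+ j.+1]exprS; lra.
Qed.

(** With n steps of length [a / n], [flow_near] bounds the squared distance from the endpoint to K
    by [C (a^2 / n) (1 + 2 |a| / n)^n], at most [G / n]. As n is arbitrary, the distance is 0. *)
Lemma flow_invariant (K : set pt) k x (a : R) :
  closed K -> K x ->
  (forall y z, K z -> (forall w, K w -> dotv (y - z) (y - z) <= dotv (y - w) (y - w)) ->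
    hgrad z ((y - z) 0) = 0) ->
  K (hflow k a x).
Proof.
move=> cK Kx Kn; set y := hflow k a x.
have [z Kz zmin] := nearest_point y cK (ex_intro _ x Kx).
set C := dotv (hfield k x) (hfield k x).
have C0 : 0 <= C by exact: dotv_ge0.
pose G := C * a ^+ 2 * expR (2 * `|a|).
have G0 : 0 <= G by rewrite mulr_ge0 ?expR_ge0 // mulr_ge0 // sqr_ge0.
have bnd j : j.+1%:R * dotv (y - z) (y - z) <= G.
  have [w Kw wE] := flow_near k (a / j.+1%:R) j.+1 cK Kx Kn.
  rewrite mulrC divfK // -/y -/C in wE.
  apply: (@le_trans _ _ (j.+1%:R * (j.+1%:R * C * (a / j.+1%:R) ^+ 2 *
            (1 + 2 * `|a / j.+1%:R|) ^+ j.+1))).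
    by apply: ler_wpM2l => //; exact: le_trans (zmin _ Kw) wE.
  have -> : j.+1%:R * (j.+1%:R * C * (a / j.+1%:R) ^+ 2 *
            (1 + 2 * `|a / j.+1%:R|) ^+ j.+1) = C * a ^+ 2 * (1 + 2 * `|a / j.+1%:R|) ^+ j.+1.
    by field; rewrite addrC natr1 pnatr_eq0.
  apply: ler_wpM2l; first by rewrite mulr_ge0 // sqr_ge0.
  have -> : expR (2 * `|a|) = expR (2 * `|a / j.+1%:R|) ^+ j.+1.
    rewrite -expRM_natr normrM normfV normr_nat; congr expR.
    by rewrite mulrA divfK.
  by apply: lerXn2r; rewrite ?nnegrE ?expR_ge0 ?expR_ge1Dx // addr_ge0 // mulr_ge0.
suff /eqP : dotv (y - z) (y - z) == 0 by move/eqP; rewrite dotv_eq0 subr_eq0 => /eqP ->.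
rewrite eq_le dotv_ge0 andbT leNgt; apply/negP => e0.
have := bnd (Num.trunc (G / dotv (y - z) (y - z))).
rewrite leNgt => /negP[]; rewrite -ltr_pdivrMr //.
exact: truncnS_gt.
Qed.

(* The commutator of the flows of X_1 and X_(d+1) is a translation in the last coordinate. *)
Lemma flow_reach (K : set pt) : (0 < d)%N -> K !=set0 ->
  (forall k a x, K x -> K (hflow k a x)) -> forall y, K y.
Proof.
move=> d0 [x0 Kx0] Kf y.
have [x Kx xy] : exists2 x, K x & forall k, x 0 (hidx k) = y 0 (hidx k).
  have [|x Kx xy] := (_ : forall m, (m <= 2 * d)%N ->
      exists2 x, K x & forall k : 'I_(2 * d), (k < m)%N -> x 0 (hidx k) = y 0 (hidx k)) _ (leqnn _).
    elim=> [_|m IH mlt]; first by exists x0.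
    have [x Kx xy] := IH (ltnW mlt); pose k := Ordinal mlt.
    exists (hflow k (y 0 (hidx k) - x 0 (hidx k)) x); first exact: Kf.
    move=> l; rewrite ltnS leq_eqVlt hflowE (inj_eq (@hidx_inj d)) hidx_neq_max /= mulr0 addr0.
    case: (eqVneq l k) => [-> _|lk]; first by rewrite mulr1 addrC subrK.
    case/orP => [/eqP lm|/xy ->]; last by rewrite mulr0 addr0.
    by move/eqP: lk => []; exact: val_inj.
  by exists x => // k; apply: xy.
have lt0 : (0 < 2 * d)%N by rewrite muln_gt0.
pose k := Ordinal lt0; pose l := hpair k.
have lk : hpair l = k by exact: hpairK.
have ltk : (k < d)%N by [].
have hk : hsign R k = 1 by rewrite /hsign ltk.
have hl : hsign R l = -1 by rewrite hsign_hpair hk.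
(* The loop with sides [a] and 1 closes up horizontally and lowers the last coordinate by [4 a]. *)
pose a := (x 0 ord_max - y 0 ord_max) / 4.
suff <- : hflow l (-1) (hflow k (- a) (hflow l 1 (hflow k a x))) = y.
  by do 4 apply: (Kf).
have tauk z : xtau z 0 k = 2 * z 0 (hidx l) by rewrite mxE hk mul1r partner_hpair.
have taul z : xtau z 0 l = - 2 * z 0 (hidx k) by rewrite mxE hl partner_hpair lk; ring.
have kl : (k == l) = false by rewrite eq_sym hpair_neq.
apply/rowP; apply: ord_hidxP => [i|].
  rewrite !(hflowE, tauk, taul) !(inj_eq (@hidx_inj d)) !hidx_neq_max -xy /=; ring.
rewrite !(hflowE, tauk, taul) !(inj_eq (@hidx_inj d)) !hidx_neq_max.
rewrite ![ord_max == hidx _]eq_sym !hidx_neq_max !eqxx (eq_sym l) kl /= /a.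
by field.
Qed.

End propagation.

(** * Strong maximum principle *)

Section strong_maximum.
Context {R : realType} {d : nat}.
Notation N := (2 * d).+1.
Notation pt := 'rV[R]_N.
Context (lam Lam : R) (A : Type) (b : A -> pt -> 'rV[R]_(2 * d)).

Definition locally_bounded_family := forall z : pt, exists2 B : R, 0 <= B &
  forall x, `|x - z| < 1 -> forall al k, `|b al x 0 k| <= B.

Lemma strong_maximum (u : pt -> R) xm : (0 < d)%N -> 0 < lam -> lam <= Lam ->
  locally_bounded_family -> (forall x, usc_at u x) ->
  jet_subsol lam Lam b (fun _ _ => 0) (fun=> True) u ->
  (forall x, u x <= u xm) -> forall x, u x = u xm.
Proof.
move=> d0 lam0 lamLam bB uu usub um.
pose K := [set x | u xm <= u x].
have cK : closed K by exact: closed_superlevel.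
have Kxm : K xm by rewrite /K /=.
suff KT y : K y by move=> x; apply/eqP; rewrite eq_le um KT.
apply: (flow_reach (K := K)) => //; first by exists xm.
move=> k a x Kx; apply: flow_invariant => // {k a x Kx} y z Kz zmin.
have [B B0 zB] := bB z.
have uz : u z = u xm by apply/eqP; rewrite eq_le um Kz.
apply: (hopf (v := u) (m := u xm) (kap := 1) (r := 1) lam0 lamLam _ _ B0 zB) => //.
  by move=> f g H x J _; exact: (usub f g H x J I).
(* The ball with diameter [[z, y]] meets the sphere about y through z only at z: [bump >= 0] gives
   [|y - x|^2 <= |y - z|^2 - |x - z|^2]. So K has no other point in it. *)
move=> x _ xz q0; rewrite ltNge; apply/negP => Kx.
have := zmin x Kx; apply/negP; rewrite -ltNge.
have -> : y - x = (y - z) + (-1) *: (x - z).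
  by apply/rowP => i; rewrite !mxE; ring.
move: q0; rewrite /bump dotv_addZ (dotvC (y - z) (x - z)).
have : 0 < dotv (x - z) (x - z) by rewrite lt_neqAle eq_sym dotv_eq0 subr_eq0 xz dotv_ge0.
lra.
Qed.

End strong_maximum.

(** The difference of the two sides has derivative [(a - 1)^3 / a], so its minimum is 0, at 1. The
    quadratic Taylor polynomial lies below [ln] for [a > 1]; the cubic term repairs this without
    changing the 2-jet at 1. *)
Lemma ln_le_cubic {R : realType} (a : R) : 0 < a ->
  ln a <= (a - 1) - 2^-1 * (a - 1) ^+ 2 + 3^-1 * (a - 1) ^+ 3.
Proof.
move=> a0.
pose P : {poly R} := ('X - 1) - 2^-1 *: ('X - 1) ^+ 2 + 3^-1 *: ('X - 1) ^+ 3.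
have PE x : P.[x] = (x - 1) - 2^-1 * (x - 1) ^+ 2 + 3^-1 * (x - 1) ^+ 3.
  by rewrite /P !hornerE.
have dP x : (deriv P).[x] = 1 - (x - 1) + (x - 1) ^+ 2.
  by rewrite /P !(poly.derivE, hornerE) /=; field.
pose f (x : R) := P.[x] - ln x.
have df (x : R) : 0 < x -> is_derive x 1 f ((x - 1) ^+ 3 / x).
  move=> x0; have -> : (x - 1) ^+ 3 / x = (deriv P).[x] - x^-1.
    by rewrite dP; field; rewrite gt_eqF.
  by apply: is_deriveB; exact: is_derive1_ln.
have fc (x y : R) : 0 < x -> {within `[x, y], continuous f}.
  move=> x0; apply: derivable_within_continuous => z; rewrite in_itv /= => /andP[xz _].
  by have [] := df z (lt_le_trans x0 xz).
rewrite -PE -subr_ge0 -/(f a).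
have <- : f 1 = 0 by rewrite /f PE ln1 subrr !expr0n /= !mulr0; lra.
rewrite -subr_ge0; have [a1|a1|->] := ltgtP a 1; last by rewrite subrr.
- have [|c] := @MVT _ f (fun x => (x - 1) ^+ 3 / x) a 1 a1 _ (fc _ _ a0).
    by move=> x; rewrite in_itv /= => /andP[ax _]; apply/df/(lt_trans a0).
  rewrite in_itv /= => /andP[ac c1] fE.
  rewrite -oppr_le0 opprB fE; apply: mulr_le0_ge0; last by rewrite subr_ge0 ltW.
  rewrite pmulr_lle0 ?invr_gt0 ?(lt_trans a0) //.
  by rewrite exprS; apply: mulr_le0_ge0; rewrite ?sqr_ge0 // subr_le0 ltW.
- have [|c] := @MVT _ f (fun x => (x - 1) ^+ 3 / x) 1 a a1 _ (fc _ _ ltr01).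
    by move=> x; rewrite in_itv /= => /andP[ax _]; apply/df/(lt_trans ltr01).
  rewrite in_itv /= => /andP[c1 ca] ->; apply: mulr_ge0; last by rewrite subr_ge0 ltW.
  by rewrite divr_ge0 ?exprn_ge0 ?subr_ge0 ?ltW // (lt_trans ltr01).
Qed.

(** * The gauge and the horizontal Hessian of its logarithm *)

Section gauge.
Context {R : realType} {d : nat}.
Notation N := (2 * d).+1.
Notation pt := 'rV[R]_N.
Implicit Types (x y z : pt).

Definition rho4 x : R := xHnorm2 x ^+ 2 + x 0 ord_max ^+ 2.

Definition hpos x : 'rV[R]_(2 * d) := \row_k x 0 (hidx k).

(** The vector [J x_H] for the complex structure J that pairs coordinates k and k + d; [xtau] is
    twice it. *)
Definition hrot x : 'rV[R]_(2 * d) := \row_k (hsign R k * x 0 (partner k)).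

Lemma rho4_ge0 x : 0 <= rho4 x.
Proof. by rewrite addr_ge0 // sqr_ge0. Qed.

Lemma rhoX4 x : rho x ^+ 4 = rho4 x.
Proof. by rewrite (exprM _ 2 2) /rho !sqr_sqrtr ?sqrtr_ge0 // rho4_ge0. Qed.

Lemma ln_rho x : 0 < rho4 x -> ln (rho x) = ln (rho4 x) / 4.
Proof.
move=> s0; have r0 : 0 < rho x by rewrite /rho !sqrtr_gt0.
by rewrite -rhoX4 lnXn // -[ln _ *+ 4]mulr_natr mulfK.
Qed.

Lemma dotv_hpos x : dotv (hpos x) (hpos x) = xHnorm2 x.
Proof. by apply: eq_bigr => k _; rewrite !mxE expr2. Qed.

Lemma hrotE x k : hrot x 0 k = - hsign R (hpair k) * hpos x 0 (hpair k).
Proof. by rewrite !mxE partner_hpair hsign_hpair opprK. Qed.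

Lemma dotv_hrot x : dotv (hrot x) (hrot x) = xHnorm2 x.
Proof.
rewrite -dotv_hpos /dotv [RHS](reindex_inj (inv_inj (@hpairK d))).
apply: eq_bigr => k _; rewrite !hrotE -[RHS]mul1r -(hsign_sqr (hpair k)); ring.
Qed.

Lemma dotv_hpos_hrot x : dotv (hpos x) (hrot x) = 0.
Proof.
have E : dotv (hpos x) (hrot x) = - dotv (hpos x) (hrot x).
  rewrite {1}/dotv (reindex_inj (inv_inj (@hpairK d))) -sumrN.
  by apply: eq_bigr => k _; rewrite !hrotE hpairK hsign_hpair; ring.
by move: E; lra.
Qed.

Lemma hetaE x : heta x = xHnorm2 x *: hpos x + x 0 ord_max *: hrot x.
Proof. by apply/rowP => k; rewrite !mxE; ring. Qed.

Definition rho4_d1 (i : 'I_N) x : R :=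
  4 * xHnorm2 x * (i != ord_max)%:R * x 0 i + 2 * (i == ord_max)%:R * x 0 ord_max.

Definition rho4_d2 (i j : 'I_N) x : R :=
  4 * xHnorm2 x * (i != ord_max)%:R * (i == j)%:R
  + 8 * ((i != ord_max)%:R * x 0 i) * ((j != ord_max)%:R * x 0 j)
  + 2 * (i == ord_max)%:R * (j == ord_max)%:R.

Lemma jet_rho4 : jet rho4 rho4_d1 rho4_d2.
Proof.
have Jr : jet (@xHnorm2 R d) (fun i x => 2 * (i != ord_max)%:R * x 0 i)
    (fun i j _ => 2 * (i != ord_max)%:R * (i == j)%:R).
  have Jk (k : 'I_N) := jetZ (k != ord_max)%:R (jetM (jet_coord (R := R) k) (jet_coord k)).
  apply: jet_ext (jet_sum Jk) _ _ _ => [x|i x|i j x].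
  - rewrite sum_hidx eqxx mul0r addr0; apply: eq_bigr => k _.
    by rewrite hidx_neq_max mul1r expr2.
  - rewrite -[RHS](sum_delta (fun k => 2 * (k != ord_max)%:R * x 0 k)).
    by apply: eq_bigr => k _; ring.
  - transitivity (\sum_k (i == k)%:R * (2 * (k != ord_max)%:R * (k == j)%:R) : R).
      by apply: eq_bigr => k _; rewrite (eq_sym j); ring.
    by rewrite sum_delta.
have Jt := jet_coord (R := R) (@ord_max (2 * d)).
apply: jet_ext (jetD (jetM Jr Jr) (jetM Jt Jt)) _ _ _ => [x|i x|i j x].
- by rewrite /rho4 !expr2.
- by rewrite /rho4_d1; ring.
- by rewrite /rho4_d2; ring.
Qed.

(** Origin of [eta] in the growth condition: the horizontal gradient of [log rho] is
    [eta / rho^4]. *)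
Lemma hgrad_rho4 x : hgrad x (rho4_d1^~ x) = 4 *: heta x.
Proof.
apply/rowP => k; rewrite !mxE /rho4_d1 hidx_neq_max eqxx /=; ring.
Qed.

Lemma hhess_rho4 x : hhess x (fun i j => rho4_d2 i j x) =
  (4 * xHnorm2 x)%:M + 8 *: ((hpos x)^T *m hpos x + (hrot x)^T *m hrot x).
Proof.
apply/matrixP => k l; rewrite [LHS]mxE !mxE !big_ord1 !mxE /rho4_d2.
rewrite (inj_eq (@hidx_inj d)) ![ord_max == hidx _]eq_sym !hidx_neq_max eqxx /=.
by rewrite -mulr_natr; ring.
Qed.

(** Where [rho4 x > 0], the horizontal Hessian of [log rho], written as [ln rho4 / 4]. *)
Definition log_hess x : 'M[R]_(2 * d) :=
  (4 * rho4 x)^-1 *: hhess x (fun i j => rho4_d2 i j x)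
  - (2 / rho4 x) ^+ 2 *: ((heta x)^T *m heta x).

(* With [zeta = |x_H|^2 Jx - t x], the pair [eta, zeta] is orthogonal, of common squared length
   [|x_H|^2 rho^4], and [log_hess = |x_H|^2/rho^4 I + 2 rho^-8 (zeta zeta^T - eta eta^T)]. *)
Lemma trace_log_hess_le (lam Lam : R) Am x : pucci_adm lam Lam Am -> 0 < rho4 x ->
  \tr (Am *m log_hess x) <=
  xHnorm2 x / rho4 x * (Lam * ((2 * d + 2)%:R - 1) - lam).
Proof.
move=> hA s0; set r := xHnorm2 x; set s := rho4 x; set t := x 0 ord_max.
pose q v := dotv (v *m Am) v.
pose zeta := r *: hrot x + - t *: hpos x.
have sE : s = r ^+ 2 + t ^+ 2 by [].
have r0 : 0 <= r by rewrite /r -dotv_hpos dotv_ge0.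
(* The pair (eta, zeta) is (x, Jx) rotated and scaled by [sqrt s], which multiplies the sum of the
   two values of a quadratic form by s. *)
have qE : q (heta x) + q zeta = s * (q (hpos x) + q (hrot x)).
  rewrite /q hetaE /zeta -/r -/t !mulmxDl -!scalemxAl !dotvDl !dotvDr !dotvZl !dotvZr sE.
  by ring.
have trE : \tr (Am *m log_hess x) = (r * s * \tr Am + 2 * q zeta - 2 * q (heta x)) / s ^+ 2.
  have -> : r * s * \tr Am + 2 * q zeta - 2 * q (heta x) =
      r * s * \tr Am + 2 * (s * (q (hpos x) + q (hrot x))) - 4 * q (heta x).
    by rewrite -qE; ring.
  rewrite /log_hess hhess_rho4 mulmxBr -!scalemxAr mulmxDr mul_mx_scalar -!scalemxAr.
  rewrite mulmxDr raddfB /= !mxtraceZ mxtraceD !mxtraceZ mxtraceD !mxtrace_mul_outer.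
  by rewrite -/r -/s -/(q _) -/(q _) -/(q _); field; rewrite gt_eqF.
rewrite trE ler_pdivrMr ?exprn_gt0 //.
have -> : r / s * (Lam * ((2 * d + 2)%:R - 1) - lam) * s ^+ 2 =
    r * s * (Lam * ((2 * d + 2)%:R - 1) - lam) by field; rewrite gt_eqF.
have ee : dotv (heta x) (heta x) = r * s.
  rewrite hetaE !dotvDl !dotvDr !dotvZl !dotvZr dotv_hpos dotv_hrot.
  by rewrite (dotvC (hrot x)) dotv_hpos_hrot sE -/r -/t; ring.
have zz : dotv zeta zeta = r * s.
  rewrite /zeta !dotvDl !dotvDr !dotvZl !dotvZr dotv_hpos dotv_hrot.
  by rewrite (dotvC (hrot x)) dotv_hpos_hrot sE -/r -/t; ring.
have ez : dotv (heta x) zeta = 0.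
  rewrite /zeta hetaE !dotvDl !dotvDr !dotvZl !dotvZr dotv_hpos dotv_hrot.
  by rewrite (dotvC (hrot x)) dotv_hpos_hrot -/r -/t; ring.
have [_ hA'] := hA.
have /andP[qe1 qe2] := hA' (heta x); have /andP[qz1 qz2] := hA' zeta.
rewrite -/(q _) ee in qe1 qe2; rewrite -/(q _) zz in qz1 qz2.
have [rs0|rs0] := eqVneq (r * s) 0.
  by rewrite rs0 !mulr0 in qe1 qe2 qz1 qz2 *; rewrite !mul0r; lra.
have m0 : 0 < r * s by rewrite lt_neqAle eq_sym rs0 mulr_ge0 // ltW.
have psd v : 0 <= dotv (v *m (Lam%:M - Am)) v.
  have /andP[_] := hA' v.
  rewrite mulmxBr mul_mx_scalar dotvDl dotvZl -scaleN1r dotvZl mulN1r subr_ge0 //.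
(* Applied to [Lam - Am], this gives [r s tr Am <= (2d - 2) Lam r s + q eta + q zeta]. The numerator
   is then at most [(2d - 2) Lam r s + 3 q zeta - q eta], and [(2d - 2) + 3 = Q - 1]. *)
have := psd_orthogonal_pair_le_trace m0 psd ee zz ez.
have trB : \tr (Lam%:M - Am) = Lam * (2 * d)%:R - \tr Am.
  by rewrite raddfB /= mxtrace_scalar mulr_natr.
have qB v : dotv (v *m (Lam%:M - Am)) v = Lam * dotv v v - q v.
  by rewrite mulmxBr mul_mx_scalar dotvDl dotvZl -scaleN1r dotvZl mulN1r.
rewrite trB !qB ee zz natrD.
nra.
Qed.

End gauge.

(** * Comparison with [eps log rho] and the Liouville property *)

Section liouville.
Context {R : realType} {d : nat}.
Notation N := (2 * d).+1.
Notation pt := 'rV[R]_N.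
Context (lam Lam : R) (A : Type) (b : A -> pt -> 'rV[R]_(2 * d)) (c : A -> pt -> R).
Implicit Types (x y z : pt).

(* [ln (1 + y) <= y - y^2/2 + y^3/3] replaces [ln rho] by a polynomial in the test function. *)
Lemma sub_log_rho_jet (u : pt -> R) (D : pt -> Prop) (R0 eps : R) : 0 < eps ->
  jet_subsol lam Lam b (fun a x => c a x * u x) (fun=> True) u ->
  (forall a x, 0 <= c a x) ->
  (forall x, R0 <= rho x -> xHnorm2 x != 0 -> forall a,
     dotv (b a x) (heta x) / xHnorm2 x - c a x * (rho x ^+ 4 / xHnorm2 x) * ln (rho x)
     <= lam - Lam * ((2 * d + 2)%:R - 1)) ->
  (forall x, D x -> [/\ R0 <= rho x, 1 <= rho4 x
      & forall a, 0 <= c a x * (u x - eps * ln (rho x))]) ->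
  jet_subsol lam Lam b (fun _ _ => 0) D (fun x => u x - eps * ln (rho x)).
Proof.
move=> eps0 usub c0 hg hD f g H x J Dx mx p q hp hq.
have [rx s1 cu] := hD x Dx; have s0 : 0 < rho4 x by exact: lt_le_trans s1.
set s := rho4 x in s0 s1.
pose P : {poly R} := 'X - 2^-1 *: 'X ^+ 2 + 3^-1 *: 'X ^+ 3.
have PE t : P.[t] = t - 2^-1 * t ^+ 2 + 3^-1 * t ^+ 3 by rewrite /P !hornerE.
have P1 : (deriv P).[0] = 1 by rewrite /P !(poly.derivE, hornerE) /=; ring.
have P2 : (deriv (deriv P)).[0] = -1.
  by rewrite /P !(poly.derivE, hornerE) /=; field.
have Jy := jetD (jetZ s^-1 (jet_rho4 (R := R) (d := d))) (jet_cst (- 1)).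
have JF := jetD J (jetZ (eps / 4) (jet_horner P Jy)).
have y0 : s^-1 * rho4 x + - 1 = 0 by rewrite mulVf ?subrr // gt_eqF.
have P0 : P.[0] = 0 by rewrite PE; ring.
have near_s : \forall y \near x, 0 < rho4 y.
  exact: (cvgr_gt _ (jet_continuous (jet_rho4 (R := R) (d := d)) (x := x))).
have mxF : \forall y \near x, u y - (f y + eps / 4 * P.[s^-1 * rho4 y + -1])
                        <= u x - (f x + eps / 4 * P.[s^-1 * rho4 x + -1]).
  move: mx near_s; apply: filterS2 => y my sy.
  rewrite y0 P0; move: my; rewrite !ln_rho // -/s.
  have t0 : 0 < s^-1 * rho4 y by rewrite mulr_gt0 ?invr_gt0.
  have := ln_le_cubic t0; rewrite -PE lnM ?posrE ?invr_gt0 // lnV ?posrE //.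
  by move=> /(ler_wpM2l (ltW eps0)); lra.
set kap := xHnorm2 x / s.
set T := Lam * ((2 * d + 2)%:R - 1) - lam in hg.
have gE : hgrad x (fun i => g i x + eps / 4 * ((deriv P).[s^-1 * rho4 x + -1] *
      (s^-1 * rho4_d1 i x + 0))) = hgrad x (g^~ x) + (eps / s) *: heta x.
  have -> : (eps / s) *: heta x = (eps / 4 / s) *: hgrad x (rho4_d1^~ x).
    by rewrite hgrad_rho4 scalerA; congr (_ *: _); field; rewrite gt_eqF.
  by rewrite y0 P1; apply/rowP => k; rewrite !mxE; ring.
have HE : hhess x (fun i j => H i j x + eps / 4 * ((deriv (deriv P)).[s^-1 * rho4 x + -1] *
      ((s^-1 * rho4_d1 i x + 0) * (s^-1 * rho4_d1 j x + 0)) +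
      (deriv P).[s^-1 * rho4 x + -1] * (s^-1 * rho4_d2 i j x + 0))) =
    hhess x (fun i j => H i j x) + eps *: log_hess x.
  have -> : log_hess x = (4 * s)^-1 *: hhess x (fun i j => rho4_d2 i j x)
      - (4 * s ^+ 2)^-1 *: ((hgrad x (rho4_d1^~ x))^T *m hgrad x (rho4_d1^~ x)).
    rewrite /log_hess -/s; congr (_ - _); apply/matrixP => k l.
    by rewrite hgrad_rho4 !mxE !big_ord1 !mxE; field; rewrite gt_eqF.
  rewrite y0 P1 P2; apply/matrixP => k l; rewrite !mxE !big_ord1 !mxE.
  by field; rewrite gt_eqF.
(* The Hessian of [eps log rho] costs at most [eps kap T] in the second order part; the growth
   condition returns the same amount in the first order part, so [p + q] is unchanged. *)
have := usub _ _ _ x JF I mxF (p - eps * (kap * T)) (q + eps * (kap * T)).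
rewrite addrACA addNr addr0; apply.
- move=> Am hA; rewrite HE mulmxDr -scalemxAr mxtraceD mxtraceZ.
  have := ler_wpM2l (ltW eps0) (trace_log_hess_le hA s0); rewrite -/s -/kap -/T.
  by have := hp Am hA; lra.
- move=> a; rewrite gE dotvDr dotvZr.
  suff : kap * T <= c a x * ln (rho x) - dotv (b a x) (heta x) / s.
    move=> /(ler_wpM2l (ltW eps0)); have := hq a; have := cu a; lra.
  (* On the vertical axis the growth condition says nothing, but there [kap] and [eta] vanish and
     [c ln rho >= 0] is enough. *)
  have [r0|r0] := eqVneq (xHnorm2 x) 0.
    have heta0 : heta x = 0.
      have /eqP hr0 : hrot x == 0 by rewrite -dotv_eq0 dotv_hrot r0.
      by rewrite hetaE r0 scale0r hr0 scaler0 addr0.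
    rewrite /kap r0 heta0 !mul0r; have /eqP -> : dotv (b a x) 0 == 0.
      by rewrite /dotv big1 // => i _; rewrite mxE mulr0.
    by rewrite mul0r subr0 mulr_ge0 // ln_rho // divr_ge0 // ln_ge0.
  have kap0 : 0 <= kap.
    by rewrite divr_ge0 ?(ltW s0) // -dotv_hpos dotv_ge0.
  have := ler_wpM2l kap0 (hg x rx r0 a); rewrite rhoX4 -/s /kap.
  have -> : xHnorm2 x / s * (dotv (b a x) (heta x) / xHnorm2 x -
      c a x * (s / xHnorm2 x) * ln (rho x)) = dotv (b a x) (heta x) / s - c a x * ln (rho x).
    by field; rewrite r0 gt_eqF.
  by rewrite /T; lra.
Qed.

(** If the sup norm is attained at the last coordinate, its square is a summand of [rho4]. Otherwise
    its square is at most [|x_H|^2], which is at least 1 and hence at most its own square. *)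
Lemma norm_sqr_le_rho4 x : 1 <= `|x| -> `|x| ^+ 2 <= rho4 x.
Proof.
move=> x1; have : mx_norm x != 0.
  by rewrite -[mx_norm x]/`|x| gt_eqF // (lt_le_trans ltr01).
move=> /mx_norm_neq0[[i j] /=]; rewrite -[mx_norm x]/`|x| ord1 => xj.
rewrite xj in x1 *; rewrite real_normK ?num_real //.
have x2 : 1 <= x 0 j ^+ 2 by rewrite -[x 0 j ^+ 2]real_normK ?num_real // exprn_ege1.
move: j x1 x2 {xj}; apply: ord_hidxP => [k|] x1 x2; last first.
  by rewrite /rho4 lerDr sqr_ge0.
have xk : x 0 (hidx k) ^+ 2 <= xHnorm2 x.
  rewrite /xHnorm2 (bigD1 k) //= lerDl; apply: sumr_ge0 => l _; exact: sqr_ge0.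
apply: (@le_trans _ _ (xHnorm2 x ^+ 2)); last by rewrite /rho4 lerDl sqr_ge0.
apply: (le_trans xk); rewrite expr2 ler_peMl ?(le_trans x2) //.
by rewrite -dotv_hpos dotv_ge0.
Qed.

Lemma norm_le_enorm n (x : 'rV[R]_n) : `|x| <= enorm x.
Proof.
by rewrite -normr_id -sqrtr_sqr ler_wsqrtr // (le_trans (normr_sqr_le_dotv x)).
Qed.

Lemma compact_superlevel n (v : 'rV[R]_n -> R) (S : set 'rV[R]_n) (m : R) :
  compact S ->
  (forall z : 'rV[R]_n, S z -> usc_at v z) -> compact (S `&` [set x | m <= v x]).
Proof.
move=> cS vS F FF FSm; have FS : F S by apply: filterS FSm => x [].
have [x [Sx clx]] := cS F FF FS; exists x; split=> //; split=> //=.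
rewrite leNgt; apply/negP => vm.
have e0 : 0 < m - v x by rewrite subr_gt0.
have [w [[_ mw] /=]] := clx _ _ FSm (vS x Sx _ e0).
by rewrite addrC subrK ltNge mw.
Qed.

(* An argmax of [v] with largest first coordinate violates [hopf] in that direction. *)
Lemma annulus_max (v : pt -> R) (L L' kap : R) : (0 < d)%N -> 0 < lam -> lam <= Lam ->
  locally_bounded_family b ->
  (forall x, L <= `|x| -> usc_at v x) -> 0 < kap ->
  forall x2, L <= `|x2| <= L' -> (forall x, L <= `|x| <= L' -> v x <= v x2) ->
  (forall x, `|x| = L -> v x < v x2) -> (forall x, `|x| = L' -> v x < v x2) ->
  ~ jet_subsol lam Lam b (fun _ _ => 0) (fun x => L < `|x| /\ v x2 - kap < v x) v.
Proof.
move=> d0 lam0 lamLam bB vusc kap0 x2 x2S vmax vL vL' vsub.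
pose S := [set x : pt | L <= `|x| <= L'].
have cn : continuous (fun x : pt => `|x|) by exact: norm_continuous.
have cS : compact S.
  have -> : S = [set x : pt | `|x - 0| <= L'] `&` [set x | L <= `|x|].
    by apply/seteqP; split=> x; rewrite /S /= subr0; [move=> /andP[]|move=> [-> ->]].
  apply: compact_closedI; first exact: compact_ball.
  by have /continuous_closedP/(_ _ (@closed_ge _ L)) := cn.
have Sv x : S x -> usc_at v x by move=> /andP[/vusc].
pose K := S `&` [set x | v x2 <= v x].
have cK : compact K by exact: compact_superlevel.
have lt0 : (0 < 2 * d)%N by rewrite muln_gt0.
pose k : 'I_(2 * d) := Ordinal lt0.
have ku x : K x -> usc_at (fun y => y 0 (hidx k)) x.
  move=> _ e e0; have cc := @coord_continuous R 1 N 0 (hidx k).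
  by apply: (cvgr_lt _ (cc x)); rewrite ltrDl.
have [|z [Sz vz] zmax] := usc_compact_max cK _ ku; first by exists x2; split=> /=.
have vzE : v z = v x2 by apply/eqP; rewrite eq_le vz vmax.
have Lz : L < `|z|.
  rewrite lt_neqAle; case/andP: Sz => -> _; rewrite andbT eq_sym.
  by apply/eqP => /vL; rewrite vzE ltxx.
have zL' : `|z| < L'.
  rewrite lt_neqAle; case/andP: Sz => _ ->; rewrite andbT.
  by apply/eqP => /vL'; rewrite vzE ltxx.
pose r := Num.min 1 (Num.min (`|z| - L) (L' - `|z|)).
have r0 : 0 < r by rewrite !lt_min ltr01 !subr_gt0 Lz zL'.
have rE x : `|x - z| < r -> [/\ `|x - z| < 1, L < `|x| & `|x| < L'].
  rewrite !lt_min => /and3P[x1 xL xL']; split => //.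
    by have := ler_normD (z - x) x; rewrite subrK distrC; lra.
  by have := ler_normD (x - z) z; rewrite subrK; lra.
have [B B0 zB] := bB z.
have : hgrad z ((evec R (hidx k)) 0) = 0.
  apply: (hopf (v := v) (m := v x2) (r := r) lam0 lamLam kap0 r0 B0) => //.
  - by move=> x /rE[/zB].
  - move=> f g H x J [xk /rE[_ Lx _]]; exact: (vsub f g H x J).
  - by move=> x /rE[_ Lx xL']; apply: vmax; rewrite !ltW.
  - by move=> x /rE[_ Lx _]; apply: vusc; rewrite ltW.
  move=> x /rE[_ Lx xL'] xz q0; rewrite ltNge; apply/negP => vx.
  have Sx : S x by rewrite /S /= !ltW.
  have := zmax x (conj Sx vx); apply/negP; rewrite -ltNge.
  move: q0; rewrite /bump dotv_evec !mxE.
  have : 0 < dotv (x - z) (x - z) by rewrite lt_neqAle eq_sym dotv_eq0 subr_eq0 xz dotv_ge0.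
  lra.
move=> /rowP/(_ k); rewrite !mxE !eqxx [ord_max == hidx _]eq_sym hidx_neq_max /= => /eqP.
by rewrite mulr0 addr0 oner_eq0.
Qed.

Lemma liouville (u : pt -> R) (R0 : R) : (0 < d)%N -> 0 < lam -> lam <= Lam ->
  locally_bounded_family b -> (forall a x, 0 <= c a x) ->
  (forall x, R0 <= rho x -> xHnorm2 x != 0 -> forall a,
     dotv (b a x) (heta x) / xHnorm2 x - c a x * (rho x ^+ 4 / xHnorm2 x) * ln (rho x)
     <= lam - Lam * ((2 * d + 2)%:R - 1)) ->
  (forall x, usc_at u x) ->
  jet_subsol lam Lam b (fun a x => c a x * u x) (fun=> True) u ->
  (forall e : R, 0 < e -> exists R1 : R, forall x, R1 <= enorm x ->
     u x / ln (rho x) <= e) ->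
  ((forall a x, c a x = 0) \/ (forall x, 0 <= u x)) ->
  forall x y, u x = u y.
Proof.
move=> d0 lam0 lamLam bB c0 hg uu usub ug cu.
(* Beyond L one has [rho >= sqrt |x| >= |R0|], so the growth condition applies, and [rho4 >= 4], so
   [ln rho > 0]. *)
pose L := 2 + R0 ^+ 2.
have L2 : 2 <= L by rewrite lerDl sqr_ge0.
have far x : L <= `|x| -> [/\ R0 <= rho x, `|x| ^+ 2 <= rho4 x & 1 < rho4 x].
  move=> Lx; have x2 : 2 <= `|x| by exact: le_trans Lx.
  have x1 : 1 <= `|x| by lra.
  have sx := norm_sqr_le_rho4 x1; split=> //; last first.
    by apply: lt_le_trans sx; rewrite expr2; nra.
  rewrite (le_trans (ler_norm _)) // -sqrtr_sqr /rho ler_wsqrtr //.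
  apply: (@le_trans _ _ `|x|); first by rewrite (le_trans _ Lx) // lerDr.
  by rewrite -[leLHS]normr_id -sqrtr_sqr ler_wsqrtr.
have cL := compact_ball (z := 0 : pt) (r := L).
have [|xb xbL xbmax] := usc_compact_max cL _ (fun x _ => uu x).
  by exists 0; rewrite /= subrr normr0; lra.
suff ub x : u x <= u xb.
  have uc : jet_subsol lam Lam b (fun _ _ => 0) (fun=> True) u.
    move=> f g H x J Dx mx p q hp hq; apply: (usub f g H x J Dx mx p q hp) => a.
    apply: le_trans (hq a) _; rewrite lerD2r.
    by case: cu => [->|u0]; rewrite ?mul0r // mulr_ge0.
  by have sm := strong_maximum d0 lam0 lamLam bB uu uc ub; move=> x y; rewrite !sm.
rewrite leNgt; apply/negP => ux.
set x1 := x in ux; set M := u xb in ux.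
have x1L : L < `|x1|.
  by rewrite ltNge; apply/negP => x1L; have := xbmax x1; rewrite /= subr0 => /(_ x1L); rewrite leNgt -/M ux.
have ln_far y : L <= `|y| -> 0 < ln (rho y).
  by move=> /far[_ _ s1]; rewrite ln_rho ?divr_gt0 ?ln_gt0 // (lt_trans ltr01).
have l1 := ln_far _ (ltW x1L).
(* Puts [v x1] midway between M and [u x1]; this single eps replaces the passage to the limit. *)
pose eps := (u x1 - M) / (2 * ln (rho x1)).
have eps0 : 0 < eps by rewrite divr_gt0 ?mulr_gt0 // subr_gt0.
pose v y := u y - eps * ln (rho y).
have vx1 : M < v x1.
  have -> : v x1 = (u x1 + M) / 2 by rewrite /v /eps; field; rewrite gt_eqF.
  lra.
have [|R1 hR1] := ug (eps / 2); first by rewrite divr_gt0.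
(* Beyond [R1], [v <= - (eps / 2) ln rho], and the exponential makes this less than [- |M|]. The
   other summands place [x1] inside the annulus. *)
pose L' := `|R1| + `|x1| + L + expR (4 * `|M| / eps).
have vL' y : L' <= `|y| -> v y < M.
  move=> yL'; have e_gt0 := expR_gt0 (4 * `|M| / eps).
  have nR1 := ler_norm R1; have R1_0 := normr_ge0 R1; have x1_0 := normr_ge0 x1.
  have yL : L <= `|y| by rewrite /L' in yL'; lra.
  have [_ sy s1] := far _ yL; have s0 : 0 < rho4 y by rewrite (lt_trans ltr01).
  have uy : u y <= eps / 2 * ln (rho y).
    rewrite -ler_pdivrMr ?ln_far //; apply: hR1.
    by apply: le_trans (norm_le_enorm y); rewrite /L' in yL'; lra.
  have ly : 2 * (4 * `|M| / eps) < ln (rho4 y).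
    rewrite -ltr_expR lnK ?posrE // [2 * _]mulrC expRM_natr.
    apply: lt_le_trans sy; rewrite ltrXn2r // ?nnegrE ?expR_ge0 //.
    by rewrite /L' in yL'; lra.
  have := ltr_pM2l eps0 (2 * (4 * `|M| / eps)) (ln (rho4 y)); rewrite ly => ly'.
  have e4 : eps * (2 * (4 * `|M| / eps)) = 8 * `|M| by field; rewrite gt_eqF.
  have : eps * ln (rho4 y) > 8 * `|M| by rewrite -e4 ly'.
  by rewrite /v; move: uy; rewrite ln_rho //; have := ler_norm (- M); rewrite normrN; lra.
have vusc y : L <= `|y| -> usc_at v y.
  move=> yL; have [_ _ s1] := far _ yL; have s0 : 0 < rho4 y by rewrite (lt_trans ltr01).
  pose w z := - (eps / 4) * ln (rho4 z).
  have vw : \forall z \near y, v z = u z + w z.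
    have : \forall z \near y, 0 < rho4 z.
      exact: (cvgr_gt _ (jet_continuous (jet_rho4 (R := R) (d := d)) (x := y))).
    by apply: filterS => z sz; rewrite /v /w ln_rho //; ring.
  have wc : {for y, continuous w}.
    apply: continuousM; first exact: cst_continuous.
    apply: (@continuous_comp _ _ _ (@rho4 R d) (@ln R)); last exact: continuous_ln.
    exact: (jet_continuous (jet_rho4 (R := R) (d := d)) (x := y)).
  have vwy := nbhs_singleton vw.
  by move=> e e0; move: (usc_atD (uu y) wc e0) vw; apply: filterS2 => z hz ->; rewrite vwy.
have x1S : L <= `|x1| <= L'.
  rewrite ltW //= /L'; have := expR_gt0 (4 * `|M| / eps); have := normr_ge0 R1; lra.
have [y [yS ymax]] : exists y, L <= `|y| <= L' /\ forall x, L <= `|x| <= L' -> v x <= v y.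
  have cn : continuous (fun x : pt => `|x|) by exact: norm_continuous.
  have cS : compact ([set x : pt | `|x - 0| <= L'] `&` [set x | L <= `|x|]).
    apply: compact_closedI; first exact: compact_ball.
    by have /continuous_closedP/(_ _ (@closed_ge _ L)) := cn.
  have [||y [yL' yL] ymax] := usc_compact_max cS (v := v).
  - by exists x1; rewrite /= subr0; case/andP: x1S.
  - by move=> z [_ /vusc].
  exists y; rewrite /= subr0 in yL'; rewrite yL yL'; split=> // z /andP[zL zL'].
  by apply: ymax; rewrite /= subr0.
have vy : M < v y by apply: lt_le_trans vx1 (ymax _ x1S).
have kap0 : 0 < v y - M by rewrite subr_gt0.
apply: (annulus_max d0 lam0 lamLam bB vusc kap0 yS ymax) => [z zL|z zL'|].
- apply: le_lt_trans vy; have := xbmax z; rewrite /= subr0 zL lexx => /(_ isT).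
  have : 0 < eps * ln (rho z) by rewrite mulr_gt0 // ln_far // zL.
  by rewrite /v -/M; lra.
- by apply: lt_trans vy; apply: vL'; rewrite zL'.
apply: (sub_log_rho_jet eps0 usub c0 hg) => z [zL].
rewrite opprB addrC subrK => Mz; have [rz _ s1] := far _ (ltW zL).
split=> //; first exact: ltW.
(* In the second case [v z > M = u xb >= 0], so the zeroth order term has the right sign. *)
move=> a; case: cu => [->|u0]; first by rewrite mul0r.
by rewrite mulr_ge0 // ltW // (le_lt_trans (u0 xb)).
Qed.

End liouville.

(** * Uniform local bound on the drift, and conclusion *)

Lemma coord_le_enorm {R : realType} n (x : 'rV[R]_n) i : `|x 0 i| <= enorm x.
Proof.
rewrite -sqrtr_sqr /enorm ler_wsqrtr // (bigD1 i) //= lerDl.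
by apply: sumr_ge0 => j _; exact: sqr_ge0.
Qed.

Lemma enorm_le_norm {R : realType} n (x : 'rV[R]_n) : enorm x <= n%:R * `|x|.
Proof.
have x0 : 0 <= n%:R * `|x| by rewrite mulr_ge0.
have xi i : `|x 0 i| <= `|x|.
  rewrite -[leRHS]/(mx_norm x) mx_normrE; apply/bigmax_geP; right => /=.
  by exists (0, i).
rewrite -[leRHS]ger0_norm // -sqrtr_sqr /enorm ler_wsqrtr //.
case: n x x0 xi => [|n] x x0 xi; first by rewrite big_ord0 sqr_ge0.
apply: (@le_trans _ _ (\sum_(i < n.+1) `|x| ^+ 2)).
  apply: ler_sum => i _; rewrite -[leLHS]real_normK ?num_real //.
  by rewrite lerXn2r ?nnegrE.
rewrite sumr_const card_ord -[leLHS]mulr_natl exprMn ler_wpM2r ?sqr_ge0 //.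
by rewrite expr2 ler_peMl // ler1n.
Qed.

(** Finiteness of the Hamiltonians at [r = 0], [p = e_k] bounds the k-th component of [b a z]
    uniformly in a. The Lipschitz condition carries the bound to the unit cube about z, with [|K|]
    because K has no prescribed sign. *)
Lemma locally_bounded_drift {R : realType} d (A : Type)
    (b : A -> 'rV[R]_((2 * d).+1) -> 'rV[R]_(2 * d)) (c : A -> 'rV[R]_((2 * d).+1) -> R) :
  (forall x r p, has_lbound [set c a x * r - dotv (b a x) p | a in [set: A]]
              /\ has_ubound [set c a x * r - dotv (b a x) p | a in [set: A]]) ->
  (forall Rad : R, 0 < Rad -> exists K : R, forall a x y,
     enorm x <= Rad -> enorm y <= Rad -> enorm (b a x - b a y) <= K * enorm (x - y)) ->
  locally_bounded_family b.
Proof.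
move=> hfin hb z.
pose Rad : R := (2 * d).+1%:R * (`|z| + 1).
have Rad0 : 0 < Rad by rewrite mulr_gt0 // ltr_wpDl.
have [K hK] := hb Rad Rad0.
have hB k : exists B : R, forall a, `|b a z 0 k| <= B.
  have [[l hl] [m hm]] := hfin z 0 (delta_mx 0 k).
  exists (`|l| + `|m|) => a.
  have E : c a z * 0 - dotv (b a z) (delta_mx 0 k) = - b a z 0 k.
    rewrite mulr0 sub0r /dotv -(sum_delta (fun i => b a z 0 i)); congr (- _).
    by apply: eq_bigr => i _; rewrite mxE eqxx mulrC (eq_sym k).
  have := hl _ (ex_intro2 _ _ a I E); have := hm _ (ex_intro2 _ _ a I E).
  have := ler_norm m; have := ler_norm (- l); have := normr_ge0 l; have := normr_ge0 m.
  by rewrite normrN ler_norml; lra.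
have [B BP] := choice hB.
exists (`|K| * (2 * Rad) + \sum_k `|B k|).
  by rewrite addr_ge0 ?sumr_ge0 // mulr_ge0 // mulr_ge0 // ltW.
have in_ball x : `|x - z| < 1 -> enorm x <= Rad.
  move=> xz; apply: le_trans (enorm_le_norm x) _; rewrite ler_wpM2l //.
  by have := ler_normD (x - z) z; rewrite subrK; lra.
have in_ball2 x : `|x - z| < 1 -> enorm (x - z) <= 2 * Rad.
  move=> xz; apply: le_trans (enorm_le_norm _) _.
  apply: (@le_trans _ _ ((2 * d).+1%:R * 1)); first by rewrite ler_wpM2l // ltW.
  rewrite mulr1; have : (2 * d).+1%:R <= Rad by rewrite /Rad ler_peMr // lerDr.
  lra.
move=> x xz a k; rewrite -[b a x 0 k](subrK (b a z 0 k)).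
apply: le_trans (ler_normD _ _) _; apply: lerD.
  have zz : `|z - z| < 1 by rewrite subrr normr0.
  have := coord_le_enorm (b a x - b a z) k; rewrite !mxE => /le_trans; apply.
  apply: le_trans (hK a x z (in_ball _ xz) (in_ball _ zz)) _.
  apply: (@le_trans _ _ (`|K| * enorm (x - z))).
    by rewrite ler_wpM2r ?sqrtr_ge0 // ler_norm.
  by rewrite ler_wpM2l // in_ball2.
apply: le_trans (BP k a) _; apply: le_trans (ler_norm _) _.
by rewrite (bigD1 k) //= lerDl sumr_ge0.
Qed.

Theorem theorem4p2 (R : realType) (d : nat) (hd : (1 <= d)%N)
  (lam Lam : R) (hlam : 0 < lam) (hlL : lam <= Lam)
  (A : Type) (b : A -> 'rV[R]_((2 * d).+1) -> 'rV[R]_(2 * d))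
  (c : A -> 'rV[R]_((2 * d).+1) -> R)
  (* H_i and H_s are finite: the index set is nonempty and the families are bounded *)
  (hA : inhabited A)
  (hfin : forall x r p, has_lbound [set c a x * r - dotv (b a x) p | a in [set: A]]
                     /\ has_ubound [set c a x * r - dotv (b a x) p | a in [set: A]])
  (hb : forall Rad : R, 0 < Rad -> exists K : R, forall a x y,
          enorm x <= Rad -> enorm y <= Rad ->
          enorm (b a x - b a y) <= K * enorm (x - y))
  (hc0 : forall a x, 0 <= c a x)
  (hc : forall Rad : R, 0 < Rad -> forall e : R, 0 < e -> exists2 del : R, 0 < del &
          forall a x y, enorm x <= Rad -> enorm y <= Rad -> enorm (x - y) < del ->
          `|c a x - c a y| < e)
  (hgrowth : exists R0 : R, forall x, R0 <= rho x -> xHnorm2 x != 0 ->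
     forall a, dotv (b a x) (heta x) / xHnorm2 x
               - c a x * (rho x ^+ 4 / xHnorm2 x) * ln (rho x)
               <= lam - Lam * ((2 * d + 2)%:R - 1)) :
  (forall u : 'rV[R]_((2 * d).+1) -> R, usc u ->
     visc_sub (fun x r p X => pucci_minus lam Lam X + Hinf b c x r p) u ->
     (forall e : R, 0 < e -> exists R1 : R, forall x, R1 <= enorm x ->
        u x / ln (rho x) <= e) ->
     ((forall a x, c a x = 0) \/ (forall x, 0 <= u x)) ->
     forall x y, u x = u y)
  /\
  (forall v : 'rV[R]_((2 * d).+1) -> R, lsc v ->
     visc_super (fun x r p X => pucci_plus lam Lam X + Hsup b c x r p) v ->
     (forall e : R, 0 < e -> exists R1 : R, forall x, R1 <= enorm x ->
        - e <= v x / ln (rho x)) ->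
     ((forall a x, c a x = 0) \/ (forall x, v x <= 0)) ->
     forall x y, v x = v y).
Proof.
have bB := locally_bounded_drift hfin hb; have [R0 hg] := hgrowth.
split=> [u uu us ug cu|v vl vs vg cv].
- apply: (liouville hd hlam hlL bB hc0 hg) => //; exact: visc_sub_jet.
(* Part (B) is the Liouville property of [- v]. *)
suff vN x y : - v x = - v y by move=> x y; exact: oppr_inj (vN x y).
move: x y; apply: (liouville (u := fun x => - v x) hd hlam hlL bB hc0 hg).
- move=> x e e0; move: (vl x e e0); apply: filterS => y; lra.
- exact: visc_super_jet.
- move=> e e0; have [R1 h1] := vg e e0; exists R1 => x /h1.
  by rewrite mulNr lerNl.
- by case: cv => [c_0|v0]; [left|right=> x; rewrite oppr_ge0].
Qed.
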